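(* Let $n\ge1$ and $s\in\{1,\dots,1+n\}$. The Wick rotation $\Phi^{(s)}$ is a well-defined homeomorphic automorphism of the unital associative Fréchet algebra $\mathcal A(\mathbb C^{1+n})$ (with the pointwise product) that restricts to an automorphism of $\mathcal A(\mathbb C^{1+n})^{U(1)}$, and the reduced Wick rotation $\Phi^{(s)}_{\mathrm{red}}:\mathcal A(M^{(s)}_{\mathrm{red}})\to\mathcal A(M^{(1+n)}_{\mathrm{red}})$ is a well-defined homeomorphic isomorphism of unital associative Fréchet algebras (with the pointwise products).
   Context: For $s\in\{1,\dots,1+n\}$ let $\nu_k^{(s)}=+1$ for $0\le k\le s-1$ and $\nu_k^{(s)}=-1$ for $s\le k\le n$. On $\mathbb C^{1+n}$ put $J^{(s)}=\sum_{k=0}^n\nu^{(s)}_kz^k\bar z^k$, $Z^{(s)}=(J^{(s)})^{-1}(\{1\})$, $M^{(s)}_{\mathrm{red}}=Z^{(s)}/U(1)$ ($U(1)$ acting by scalar multiplication), identified with the open subset $\{[\rho]:J^{(s)}(\rho)>0\}$ of $\mathbb{CP}^n$. Let $\hat J^{(s)}(\xi,\eta)=\sum_{k=0}^n\nu^{(s)}_k\xi^k\eta^k$ on $\mathbb C^{1+n}\times\mathbb C^{1+n}$, $\hat Z^{(s)}=(\hat J^{(s)})^{-1}(\{1\})$ and $\hat M^{(s)}_{\mathrm{red}}=\hat Z^{(s)}/\mathbb C^*$, where $\alpha\in\mathbb C^*$ acts by $(\xi,\eta)\mapsto(\alpha\xi,\alpha^{-1}\eta)$; this is a complex manifold. Let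 $\Delta:\mathbb C^{1+n}\to\mathbb C^{1+n}\times\mathbb C^{1+n}$, $\rho\mapsto(\rho,\bar\rho)$ and $\Delta^{(s)}_{\mathrm{red}}:M^{(s)}_{\mathrm{red}}\to\hat M^{(s)}_{\mathrm{red}}$, $[\rho]\mapsto[(\rho,\bar\rho)]$ for $\rho\in Z^{(s)}$. With $\mathcal O$ denoting holomorphic functions, $\mathcal A(\mathbb C^{1+n})=\{\hat f\circ\Delta:\hat f\in\mathcal O(\mathbb C^{1+n}\times\mathbb C^{1+n})\}$ and $\mathcal A(M^{(s)}_{\mathrm{red}})=\{\hat g\circ\Delta^{(s)}_{\mathrm{red}}:\hat g\in\mathcal O(\hat M^{(s)}_{\mathrm{red}})\}$, with the Fréchet topologies of locally uniform convergence of the (unique) holomorphic extensions $\hat f$, $\hat g$. $\mathcal A(\mathbb C^{1+n})^{U(1)}$ is the subalgebra of $U(1)$-invariant functions. Let $W^{(s)}$ be the diagonal $(1+n)\times(1+n)$ matrix with entries $1$ at positions $0,\dots,s-1$ and $\mathrm i$ at positions $s,\dots,n$. Let $\alpha^{(s)}:\hat M^{(1+n)}_{\mathrm{red}}\to\hat M^{(s)}_{\mathrm{red}}$, $[(\xi,\eta)]\mapsto[(W^{(s)}\xi,W^{(s)}\eta)]$. The Wick rotation is $\Phi^{(s)}(f)(\rho)=\hat f(W^{(s)}\rho,W^{(s)}\bar\rho)$ for $f=\hat f\circ\Delta\in\mathcal A(\mathbb C^{1+n})$, and the reduced Wick rotation is $\Phi^{(s)}_{\mathrm{red}}(g)=\hat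 g\circ\alpha^{(s)}\circ\Delta^{(1+n)}_{\mathrm{red}}$ for $g=\hat g\circ\Delta^{(s)}_{\mathrm{red}}\in\mathcal A(M^{(s)}_{\mathrm{red}})$. *)

(* Defs.v *)
Set Warnings "-notation-overridden,-notation-incompatible-prefix,-ambiguous-paths".
From HB Require Import structures.
From mathcomp Require Import all_boot all_order all_algebra.
From mathcomp Require Import generic_quotient.
From mathcomp Require Import complex.
From mathcomp Require Import all_classical all_reals all_analysis.

Set Implicit Arguments.
Unset Strict Implicit.
Unset Printing Implicit Defensive.

Import Order.TTheory GRing.Theory Num.Theory.
Import numFieldNormedType.Exports.

Local Open Scope classical_set_scope.
Local Open Scope ring_scope.
Local Open Scope quotient_scope.

Record funalg (K : numFieldType) (Y : Type) := FunAlg {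
  funalg_set :> (Y -> K) -> Prop;
  funalg_one : funalg_set (cst 1);
  funalg_add : forall f g, funalg_set f -> funalg_set g ->
    funalg_set (fun y => f y + g y);
  funalg_mul : forall f g, funalg_set f -> funalg_set g ->
    funalg_set (fun y => f y * g y);
  funalg_scale : forall (a : K) f, funalg_set f ->
    funalg_set (fun y => a * f y)
}.

Section RestrictionAlgebra.
Context (K : numFieldType) (X : Type) (Y : topologicalType).
Context (O : funalg K Y) (D : X -> Y).

Definition restriction_pred : {pred (X -> K^o)} :=
  [pred f | `[< exists2 fhat : Y -> K, O fhat & f = fhat \o D >]].

Lemma restriction_pred_subring : subring_closed restriction_pred.
Proof.
have addP f g : f \in restriction_pred -> g \in restriction_pred ->
    f + g \in restriction_pred.
  move=> /asboolP[f1 Of ->] /asboolP[g1 Og ->]; apply/asboolP.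
  by exists (fun y => f1 y + g1 y) => //; exact: funalg_add.
split.
- by apply/asboolP; exists (cst 1); first exact: funalg_one.
- move=> f g fP /asboolP[g1 Og ->]; apply: addP => //; apply/asboolP.
  exists (fun y => -1 * g1 y); first exact: funalg_scale.
  by apply/funext => x /=; rewrite mulN1r.
- move=> f g /asboolP[f1 Of ->] /asboolP[g1 Og ->]; apply/asboolP.
  by exists (fun y => f1 y * g1 y) => //; exact: funalg_mul.
Qed.

HB.instance Definition _ :=
  GRing.isSubringClosed.Build (X -> K^o) restriction_pred
    restriction_pred_subring.

Lemma restriction_pred_scaler : GRing.scaler_closed restriction_pred.
Proof.
move=> a f /asboolP[f1 Of ->]; apply/asboolP.
by exists (fun y => a * f1 y) => //; exact: funalg_scale.
Qed.

HB.instance Definition _ :=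
  GRing.isScaleClosed.Build K (X -> K^o) restriction_pred
    restriction_pred_scaler.

(* The algebra {fhat \o D : fhat \in O}, with pointwise operations. *)
Record restriction_alg := RestrictionAlg {
  restriction_fun :> X -> K^o;
  _ : restriction_fun \in restriction_pred
}.

HB.instance Definition _ := [isSub for restriction_fun].
HB.instance Definition _ := [Choice of restriction_alg by <:].
HB.instance Definition _ :=
  GRing.SubChoice_isSubComPzRing.Build _ _ restriction_alg (subringClosedP _).
HB.instance Definition _ := [SubZmodule_isSubLmodule of restriction_alg by <:].

Lemma restriction_algP (f : restriction_alg) :
  exists fhat : Y -> K, O fhat /\ f = fhat \o D :> (X -> K).
Proof. by case: f => f /= /asboolP[fhat]; exists fhat. Qed.

(* A choice of extension; it is the only one when the elements of O are
   determined by their restrictions along D. *)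
Definition extension (f : restriction_alg) : {family compact, Y -> K} :=
  projT1 (cid (restriction_algP f)).

(* The topology of uniform convergence on compact sets of the extensions, which
   is locally uniform convergence since the spaces Y considered below are
   locally compact. *)
HB.instance Definition _ :=
  Topological.copy restriction_alg (initial_topology extension).

Lemma restriction_alg_scalerAl (a : K) (f g : restriction_alg) :
  a *: (f * g) = (a *: f) * g.
Proof. by apply/val_inj/funext => x /=; exact: mulrA. Qed.

End RestrictionAlgebra.

Arguments extension {K X Y O D} f.

(* Function rings over a possibly empty set may be zero rings, so MathComp's
   [algType], which is non-trivial by definition, is not available here; the
   algebra structure is the join of [comPzRingType] and [lmodType]. *)
Definition homeomorphic_alg_isomorphism (K : numFieldType)
    (X X' : Type) (Y Y' : topologicalType) (O : funalg K Y) (O' : funalg K Y')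
    (D : X -> Y) (D' : X' -> Y')
    (Phi : restriction_alg O D -> restriction_alg O' D') : Prop :=
  [/\ linear Phi, monoid_morphism Phi &
      exists Psi : restriction_alg O' D' -> restriction_alg O D,
        [/\ cancel Phi Psi, cancel Psi Phi, continuous Phi & continuous Psi]].

Section Holomorphy.
Context (K : numFieldType) (V : normedModType K).

Definition holomorphic_on (U : set V) (f : V -> K) : Prop :=
  forall x, U x -> differentiable f x.

Lemma holomorphic_on_cst U (a : K) : holomorphic_on U (cst a).
Proof. by move=> x _; exact: differentiable_cst. Qed.

Lemma holomorphic_onD U (f g : V -> K) : holomorphic_on U f ->
  holomorphic_on U g -> holomorphic_on U (fun x => f x + g x).
Proof. by move=> fU gU x Ux; apply: differentiableD; [exact: fU|exact: gU]. Qed.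

Lemma holomorphic_onM U (f g : V -> K) : holomorphic_on U f ->
  holomorphic_on U g -> holomorphic_on U (fun x => f x * g x).
Proof. by move=> fU gU x Ux; apply: differentiableM; [exact: fU|exact: gU]. Qed.

Lemma holomorphic_onS U U' (f : V -> K) :
  U `<=` U' -> holomorphic_on U' f -> holomorphic_on U f.
Proof. by move=> UU' fU' x /UU'; exact: fU'. Qed.

Definition entire : funalg K V :=
  @FunAlg K V (holomorphic_on setT) (@holomorphic_on_cst setT 1)
    (@holomorphic_onD setT) (@holomorphic_onM setT)
    (fun a f fT => holomorphic_onM (@holomorphic_on_cst setT a) fT).

End Holomorphy.

(* The norm topology of the concrete field R[i] and R[i] as a normed module over
   itself; the library provides these only for an abstract [numFieldType]. *)
HB.instance Definition _ (R : realType) := NormedModule.copy R[i] R[i]^o.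

Section WickRotation.
Context (R : realType) (n : nat).
Local Notation C := R[i].
Local Notation V := 'cV[C]_n.+1.
Local Notation V2 := (V * V)%type.

Definition conjv (rho : V) : V := map_mx Num.conj rho.

Definition nu (s : nat) (k : 'I_n.+1) : C := if (k < s)%N then 1 else -1.

Definition J (s : nat) (rho : V) : C :=
  \sum_k nu s k * rho k 0 * Num.conj (rho k 0).

Definition Jhat (s : nat) (p : V * V) : C :=
  \sum_k nu s k * p.1 k 0 * p.2 k 0.

Definition Z (s : nat) : set V := [set rho | J s rho = 1].

Definition Zhat (s : nat) : set (V * V) := [set p | Jhat s p = 1].

Definition U1_rel (s : nat) (x y : Z s) : bool :=
  `[< exists u : C, `|u| = 1 /\ val y = u *: val x >].

Lemma U1_rel_equiv s : equiv_class_of (@U1_rel s).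
Proof.
split.
- by move=> x; apply/asboolP; exists 1; rewrite normr1 scale1r.
- suff S x y : @U1_rel s x y -> U1_rel y x by move=> x y; apply/idP/idP; exact: S.
  move=> /asboolP[u [u1 e]]; apply/asboolP; exists u^-1.
  have u0 : u != 0 by rewrite -normr_eq0 u1 oner_eq0.
  by rewrite normfV u1 invr1 e scalerA mulVf// scale1r.
- move=> y x z /asboolP[u [u1 e]] /asboolP[v [v1 e']]; apply/asboolP.
  by exists (v * u); rewrite normrM u1 v1 mulr1 e' e scalerA.
Qed.

Canonical U1_equiv s := EquivRelPack (@U1_rel_equiv s).

Definition Mred (s : nat) := {eq_quot (U1_equiv s)}.

Definition Cstar_rel (s : nat) (x y : Zhat s) : bool :=
  `[< exists a : C, a != 0 /\
        val y = (a *: (val x).1, a^-1 *: (val x).2) >].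

Lemma Cstar_rel_equiv s : equiv_class_of (@Cstar_rel s).
Proof.
split.
- move=> x; apply/asboolP; exists 1.
  by rewrite oner_neq0 invr1 !scale1r -surjective_pairing.
- suff S x y : @Cstar_rel s x y -> Cstar_rel y x.
    by move=> x y; apply/idP/idP; exact: S.
  move=> /asboolP[a [a0 e]]; apply/asboolP; exists a^-1; rewrite invr_neq0//.
  by rewrite e/= !scalerA !mulVf ?invr_neq0// !scale1r -surjective_pairing.
- move=> y x z /asboolP[a [a0 e]] /asboolP[b [b0 e']]; apply/asboolP.
  by exists (b * a); rewrite mulf_neq0// e' e/= !scalerA invfM.
Qed.

Canonical Cstar_equiv s := EquivRelPack (@Cstar_rel_equiv s).

Definition Mhat (s : nat) := quotient_topology {eq_quot (Cstar_equiv s)}.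

Definition piM s (x : Z s) : Mred s := \pi_(Mred s) x.
Definition piMhat s (p : Zhat s) : Mhat s := \pi_(Mhat s) p.

(* The complex structure of the quotient manifold: the projection
   Zhat -> Mhat is a holomorphic submersion, so g is holomorphic if and only if
   its pullback to Zhat is; and a function on the closed complex submanifold
   Zhat of C^(2+2n) is holomorphic if and only if it is locally the restriction
   of a holomorphic function on an open subset of C^(2+2n). *)
Definition holomorphic_Mhat (s : nat) (g : Mhat s -> C) : Prop :=
  forall x : Zhat s, exists (U : set (V * V)) (h : V * V -> C),
    [/\ open U, U (val x), holomorphic_on U h &
        forall y : Zhat s, U (val y) -> g (piMhat y) = h (val y)].

Lemma holomorphic_Mhat_cst s (a : C) : @holomorphic_Mhat s (cst a).
Proof.
move=> x; exists setT, (cst a); split => //; exact: openT.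
Qed.

Lemma holomorphic_Mhat_op s (op : C -> C -> C) (f g : Mhat s -> C) :
  (forall U (h k : V * V -> C), holomorphic_on U h -> holomorphic_on U k ->
    holomorphic_on U (fun p => op (h p) (k p))) ->
  holomorphic_Mhat f -> holomorphic_Mhat g ->
  holomorphic_Mhat (fun m => op (f m) (g m)).
Proof.
move=> opP fP gP x.
have [U [h [oU Ux hU hE]]] := fP x; have [U' [k [oU' U'x kU' kE]]] := gP x.
exists (U `&` U'), (fun p => op (h p) (k p)); split; first exact: openI.
- by split.
- by apply: opP; [apply: holomorphic_onS hU|apply: holomorphic_onS kU'] => p [].
- by move=> y [Uy U'y]; rewrite hE// kE.
Qed.

Definition holM (s : nat) : funalg C (Mhat s) :=
  @FunAlg C (Mhat s) (@holomorphic_Mhat s) (@holomorphic_Mhat_cst s 1)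
    (fun f g => holomorphic_Mhat_op (@holomorphic_onD _ _))
    (fun f g => holomorphic_Mhat_op (@holomorphic_onM _ _))
    (fun a f => holomorphic_Mhat_op (@holomorphic_onM _ _)
                  (@holomorphic_Mhat_cst s a)).

Definition Delta (rho : V) : V * V := (rho, conjv rho).

Lemma Delta_subproof s (x : Z s) : Delta (val x) \in Zhat s.
Proof.
case: x => rho /set_mem/= Zrho; apply/mem_set; rewrite /Zhat/= -[RHS]Zrho.
by apply: eq_bigr => k _; rewrite mxE.
Qed.

Definition DeltaZ s (x : Z s) : Zhat s := 
  @exist _ (fun p => p \in Zhat s) _ (Delta_subproof x).

Definition Delta_red s (m : Mred s) : Mhat s := piMhat (DeltaZ (repr m)).

Lemma Delta_redE s (x : Z s) : Delta_red (piM x) = piMhat (DeltaZ x).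
Proof.
apply/eqmodP/asboolP.
have /eqmodP/asboolP[u [u1 e]] : \pi_(Mred s) (repr (piM x)) = piM x.
  by rewrite reprK.
have u0 : u != 0 by rewrite -normr_eq0 u1 oner_eq0.
exists u; split=> //=; rewrite /Delta e; congr pair.
rewrite /conjv map_mxZ; congr (_ *: _).
by rewrite invC_norm u1 expr1n invr1 mul1r.
Qed.

Definition W (s : nat) : 'M[C]_n.+1 :=
  diag_mx (\row_k if (k < s)%N then 1 else 'i).

Definition WW (s : nat) (p : V * V) : V * V := (W s *m p.1, W s *m p.2).

Lemma WW_subproof s (x : Zhat n.+1) : WW s (val x) \in Zhat s.
Proof.
case: x => p /set_mem/= Zp; apply/mem_set; rewrite /Zhat/= -[RHS]Zp.
apply: eq_bigr => k _; rewrite /= !mul_diag_mx !mxE /nu ltn_ord.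
case: ifP => _; rewrite ?mul1r// mulN1r mulNr mulrACA.
by rewrite -expr2 sqrCi mulN1r opprK.
Qed.

Definition WWZ s (x : Zhat n.+1) : Zhat s :=
  @exist _ (fun p => p \in Zhat s) _ (WW_subproof s x).

Definition alpha s (m : Mhat n.+1) : Mhat s := piMhat (WWZ s (repr m)).

Lemma alphaE s (x : Zhat n.+1) : alpha s (piMhat x) = piMhat (WWZ s x).
Proof.
apply/eqmodP/asboolP.
have /eqmodP/asboolP[a [a0 e]] : \pi_(Mhat n.+1) (repr (piMhat x)) = piMhat x.
  by rewrite reprK.
by exists a; split=> //=; rewrite /WW e/= !linearZ.
Qed.

Definition A_V := restriction_alg (entire V2) Delta.

Definition A_Mred (s : nat) := restriction_alg (holM s) (@Delta_red s).

Definition A_V_U1 : set A_V :=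
  [set f | forall (u : C) (rho : V), `|u| = 1 -> f (u *: rho) = f rho].

Definition is_wick_rotation (s : nat) (Phi : A_V -> A_V) : Prop :=
  forall (fhat : V2 -> C) (f : A_V), entire V2 fhat ->
    f = fhat \o Delta :> (V -> C) ->
    forall rho, Phi f rho = fhat (W s *m rho, W s *m conjv rho).

Definition is_reduced_wick_rotation (s : nat)
    (Phi : A_Mred s -> A_Mred n.+1) : Prop :=
  forall (ghat : Mhat s -> C) (g : A_Mred s), holM s ghat ->
    g = ghat \o @Delta_red s :> (Mred s -> C) ->
    Phi g = ghat \o alpha s \o @Delta_red n.+1 :> (Mred n.+1 -> C).

End WickRotation.

(* Main.v *)
Require Import Defs.
From HB Require Import structures.
From mathcomp Require Import all_boot all_order all_algebra.
From mathcomp Require Import generic_quotient.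
From mathcomp Require Import complex ring lra.
From mathcomp Require Import all_classical all_reals all_analysis.

(** Both rotations are pullbacks along biholomorphic maps, so everything reduces
    to the uniqueness of holomorphic extensions.

    For this, the identity theorem in one variable is needed for functions that
    are only assumed complex differentiable. Goursat's bisection argument is run
    on trapezoidal sums over dyadic subdivisions of the sides of a square, which
    are additive under subdivision and exact on affine functions, so that no
    integral is involved. It yields a Cauchy estimate
    [|f z0 / P z0| <= C * sup |f / P|], the supremum being over the boundary of
    the square and [P] a product of [k] linear factors vanishing at zeros of [f]
    close to the centre; letting [k] grow shows that a function with infinitely
    many zeros near the centre vanishes there.

    An entire [f] on [C^(1+n) x C^(1+n)] vanishing on the image of [Delta] is zero,
    since every point has the form [Delta p + 'i Delta q] and
    [t |-> f (Delta p + t Delta q)] vanishes for real [t]. On the quadric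
    [Jhat = 1] the same argument gives vanishing near the point [(e0, e0)]; this
    spreads to the whole quadric along the complex lines on which [xi] or [eta]
    is fixed, up to the action of [C^*]. *)

Set Implicit Arguments.
Unset Strict Implicit.
Unset Printing Implicit Defensive.

Import Order.TTheory GRing.Theory Num.Theory.
Import numFieldNormedType.Exports.

Local Open Scope classical_set_scope.
Local Open Scope ring_scope.

(** * Goursat's lemma for trapezoidal sums *)

Section Trapezoid.
Context (K : numFieldType).
Implicit Types (f g : K -> K) (a b : K).

Fixpoint trap f (N : nat) a b : K :=
  if N is M.+1 then trap f M a ((a + b) / 2) + trap f M ((a + b) / 2) b
  else (f a + f b) / 2 * (b - a).

Lemma trapC f N a b : trap f N b a = - trap f N a b.
Proof.
elim: N a b => [|N IH] a b /=; first by ring.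
by rewrite (addrC b) IH (IH a); ring.
Qed.

Lemma trapD f g c N a b :
  trap (fun z => f z + c * g z) N a b = trap f N a b + c * trap g N a b.
Proof.
elim: N a b => [|N IH] a b /=; first by ring.
by rewrite !IH; ring.
Qed.

Lemma trap_affine c d N a b :
  trap (fun z => c * z + d) N a b = c / 2 * (b ^+ 2 - a ^+ 2) + d * (b - a).
Proof.
elim: N a b => [|N IH] a b /=; first by field.
by rewrite !IH; field.
Qed.

Lemma trap_le (P : K -> Prop) f B N a b :
  (forall u v, P u -> P v -> P ((u + v) / 2)) -> P a -> P b ->
  (forall z, P z -> `|f z| <= B) -> `|trap f N a b| <= B * `|b - a|.
Proof.
move=> Pmid Pa Pb fB; elim: N a b Pa Pb => [|N IH] a b Pa Pb /=.
  rewrite normrM ler_wpM2r// normrM normfV [`|2|]ger0_norm// ler_pdivrMr//.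
  by rewrite mulr_natr mulr2n (le_trans (ler_normD _ _))// lerD ?fB.
have -> : `|b - a| = `|(a + b) / 2 - a| + `|b - (a + b) / 2|.
  have -> : (a + b) / 2 - a = (b - a) / 2 by field.
  have -> : b - (a + b) / 2 = (b - a) / 2 by field.
  by rewrite normrM normfV [`|2|]ger0_norm//; field.
rewrite mulrDr (le_trans (ler_normD _ _))// lerD ?IH//; exact: Pmid.
Qed.

End Trapezoid.

Section Squares.
Local Open Scope complex_scope.
Context (R : realType).
Local Notation C := R[i].

Lemma midC (a b c d : R) :
  (a +i* b + (c +i* d)) / 2 = ((a + c) / 2) +i* ((b + d) / 2).
Proof.
apply: (@mulIf _ 2) => //; rewrite divfK//.
by apply/eqP; rewrite eq_complex/=; apply/andP; split; apply/eqP; field.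
Qed.

Lemma ReIm_mid (z w : C) :
  complex.Re ((z + w) / 2) = (complex.Re z + complex.Re w) / 2 /\
  complex.Im ((z + w) / 2) = (complex.Im z + complex.Im w) / 2.
Proof. by case: z w => [a b] [c d]; rewrite midC. Qed.

Definition in_sq (x y h : R) (z : C) : Prop :=
  [/\ x <= complex.Re z, complex.Re z <= x + h,
      y <= complex.Im z & complex.Im z <= y + h].

Lemma in_sq_mid x y h u v :
  in_sq x y h u -> in_sq x y h v -> in_sq x y h ((u + v) / 2).
Proof.
case: u v => [u1 u2] [v1 v2] [/= ? ? ? ?] [/= ? ? ? ?].
by rewrite midC; split => /=; lra.
Qed.

Lemma Im_side_mid x y h c u v :
  in_sq x y h u /\ complex.Im u = c -> in_sq x y h v /\ complex.Im v = c ->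
  in_sq x y h ((u + v) / 2) /\ complex.Im ((u + v) / 2) = c.
Proof.
move=> [Qu e1] [Qv e2]; split; first exact: in_sq_mid.
by rewrite (ReIm_mid u v).2 e1 e2; field.
Qed.

Lemma Re_side_mid x y h c u v :
  in_sq x y h u /\ complex.Re u = c -> in_sq x y h v /\ complex.Re v = c ->
  in_sq x y h ((u + v) / 2) /\ complex.Re ((u + v) / 2) = c.
Proof.
move=> [Qu e1] [Qv e2]; split; first exact: in_sq_mid.
by rewrite (ReIm_mid u v).1 e1 e2; field.
Qed.

Lemma cousin_squares (P : R -> R -> R -> Prop) (x0 y0 h0 : R) : 0 < h0 ->
  (forall x y h, 0 < h -> P x y (h / 2) -> P (x + h / 2) y (h / 2) ->
     P x (y + h / 2) (h / 2) -> P (x + h / 2) (y + h / 2) (h / 2) -> P x y h) ->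
  (forall z, in_sq x0 y0 h0 z -> exists2 d : R, 0 < d &
     forall x y h, 0 < h -> h < d -> in_sq x y h z -> P x y h) ->
  P x0 y0 h0.
Proof.
move=> h00 Psplit Ploc; apply: contrapT => NP.
pose T := (R * R * R)%type.
pose Q (t : T) := 0 < t.2 /\ ~ P t.1.1 t.1.2 t.2.
pose sub (t u : T) := [/\ u.2 = t.2 / 2,
  t.1.1 <= u.1.1, u.1.1 <= t.1.1 + t.2 / 2,
  t.1.2 <= u.1.2 & u.1.2 <= t.1.2 + t.2 / 2].
have next t : exists u, Q t -> Q u /\ sub t u.
  have [[t0 Pt]|] := pselect (Q t); last by move=> ?; exists t.
  have t20 : 0 < t.2 / 2 by lra.
  apply: contrapT => /forallNP H; apply: Pt.
  apply: Psplit => //; apply: contrapT => NPu.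
  - by apply: (H (t.1.1, t.1.2, t.2 / 2)) => _; split; split => //=; lra.
  - by apply: (H (t.1.1 + t.2 / 2, t.1.2, t.2 / 2)) => _; split; split => //=; lra.
  - by apply: (H (t.1.1, t.1.2 + t.2 / 2, t.2 / 2)) => _; split; split => //=; lra.
  - apply: (H (t.1.1 + t.2 / 2, t.1.2 + t.2 / 2, t.2 / 2)) => _.
    by split; split => //=; lra.
have [nxt nxtP] := choice next.
pose s k := iter k nxt (x0, y0, h0).
have Qs k : Q (s k).
  by elim: k => [|k IH]; [split|have [] := nxtP _ IH].
have subs k : sub (s k) (s k.+1) by have [] := nxtP _ (Qs k).
have hs k : (s k).2 = h0 / 2 ^+ k.
  elim: k => [|k IH]; first by rewrite expr0 divr1.
  by have [-> _ _ _ _] := subs k; rewrite IH exprS; field.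
have mono k m : (k <= m)%N ->
    [/\ (s k).1.1 <= (s m).1.1, (s m).1.1 + (s m).2 <= (s k).1.1 + (s k).2,
        (s k).1.2 <= (s m).1.2 & (s m).1.2 + (s m).2 <= (s k).1.2 + (s k).2].
  move=> /subnKC <-; elim: (m - k)%N => [|d [? ? ? ?]]; first by rewrite addn0.
  have [? ? ? ? ?] := subs (k + d)%N; have [? _] := Qs (k + d)%N.
  by rewrite addnS; split; lra.
have below k m :
    (s k).1.1 <= (s m).1.1 + (s m).2 /\ (s k).1.2 <= (s m).1.2 + (s m).2.
  have [? _] := Qs k; have [? _] := Qs m.
  by have [/mono[? ? ? ?]|/ltnW/mono[? ? ? ?]] := leqP k m; split; lra.
pose xs := sup (range (fun k => (s k).1.1)).
pose ys := sup (range (fun k => (s k).1.2)).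
have inz k : in_sq (s k).1.1 (s k).1.2 (s k).2 (xs +i* ys).
  split => /=.
  - apply: ub_le_sup; last by exists k.
    by exists ((s 0%N).1.1 + (s 0%N).2) => _ [m _ <-]; have [] := below m 0%N.
  - apply: ge_sup; first by exists (s k).1.1; exists k.
    by move=> _ [m _ <-]; have [] := below m k.
  - apply: ub_le_sup; last by exists k.
    by exists ((s 0%N).1.2 + (s 0%N).2) => _ [m _ <-]; have [] := below m 0%N.
  - apply: ge_sup; first by exists (s k).1.2; exists k.
    by move=> _ [m _ <-]; have [] := below m k.
have [d d0 dP] := Ploc _ (inz 0%N).
have [k hk] : exists k, h0 / 2 ^+ k < d.
  exists (Num.bound (h0 / d)).
  rewrite ltr_pdivrMr ?exprn_gt0// mulrC -ltr_pdivrMr//.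
  apply: lt_trans (archi_boundP _) _; first by rewrite divr_ge0// ltW.
  by rewrite -natrX ltr_nat ltn_expl.
have [sk Pk] := Qs k; apply: Pk; apply: dP => //; by rewrite hs.
Qed.

End Squares.

Section Goursat.
Local Open Scope complex_scope.
Context (R : realType).
Local Notation C := R[i].
Implicit Types (f g : C -> C) (x y h : R) (z w : C).

Lemma posC (e : C) : 0 < e -> exists2 d : R, 0 < d & e = d%:C.
Proof.
by case: e => a b; rewrite ltcE/= => /andP[/eqP-> a0]; exists a.
Qed.

Lemma nearC_ex (P : C -> Prop) z : (\forall w \near z, P w) ->
  exists2 d : R, 0 < d & forall w, `|w - z| < d%:C -> P w.
Proof.
move=> /nbhs_normP[e /posC[d d0 ->] H]; exists d => // w wz.
by apply: H; rewrite /= distrC.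
Qed.

Lemma norm_le_ReIm z : `|z| <= (`|complex.Re z| + `|complex.Im z|)%:C.
Proof.
rewrite [in leLHS](complexE z) (le_trans (ler_normD _ _))// normrM.
rewrite [leRHS]rmorphD/= lerD//.
  by rewrite normc_def/= expr0n addr0 sqrtr_sqr.
by rewrite !normc_def/= !expr0n/= addr0 add0r expr1n sqrtr1 mul1r sqrtr_sqr.
Qed.

Lemma normC_real (x : R) : `|x%:C| = `|x|%:C.
Proof. by rewrite normc_def/= expr0n addr0 sqrtr_sqr. Qed.

Lemma in_sq_dist x y h z w :
  in_sq x y h z -> in_sq x y h w -> `|w - z| <= (h *+ 2)%:C.
Proof.
case: z w => [z1 z2] [w1 w2] [/= ? ? ? ?] [/= ? ? ? ?].
apply: le_trans (norm_le_ReIm _) _; rewrite lecR mulr2n lerD//=.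
  by rewrite ler_norml; lra.
by rewrite ler_norml; lra.
Qed.

Lemma ler_norm4D (a b c d a' b' c' d' : C) :
  `|a| <= a' -> `|b| <= b' -> `|c| <= c' -> `|d| <= d' ->
  `|a + b + c + d| <= a' + b' + c' + d'.
Proof.
by move=> ? ? ? ?; do 3 rewrite (le_trans (ler_normD _ _))// lerD//.
Qed.

Definition bsum f N x y h : C :=
  trap f N (x +i* y) ((x + h) +i* y)
  + trap f N ((x + h) +i* y) ((x + h) +i* (y + h))
  + trap f N ((x + h) +i* (y + h)) (x +i* (y + h))
  + trap f N (x +i* (y + h)) (x +i* y).

Lemma bsumS f N x y h : bsum f N.+1 x y h =
  bsum f N x y (h / 2) + bsum f N (x + h / 2) y (h / 2)
  + bsum f N x (y + h / 2) (h / 2) + bsum f N (x + h / 2) (y + h / 2) (h / 2).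
Proof.
rewrite /bsum /= !midC.
have e1 (u : R) : (u + (u + h)) / 2 = u + h / 2 by field.
have e2 (u : R) : (u + h + u) / 2 = u + h / 2 by field.
have e3 (u : R) : u + h / 2 + h / 2 = u + h by field.
have e4 (u : R) : (u + u) / 2 = u by field.
rewrite !e1 !e2 !e3 !e4.
rewrite (trapC f N (x +i* (y + h / 2)) ((x + h / 2) +i* (y + h / 2))).
rewrite (trapC f N ((x + h / 2) +i* y) ((x + h / 2) +i* (y + h / 2))).
rewrite (trapC f N ((x + h / 2) +i* (y + h / 2)) ((x + h) +i* (y + h / 2))).
rewrite (trapC f N ((x + h / 2) +i* (y + h / 2)) ((x + h / 2) +i* (y + h))).
ring.
Qed.

Lemma bsumD f g c N x y h :
  bsum (fun z => f z + c * g z) N x y h = bsum f N x y h + c * bsum g N x y h.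
Proof. by rewrite /bsum !trapD; ring. Qed.

Lemma bsum_affine c d N x y h : bsum (fun z => c * z + d) N x y h = 0.
Proof. by rewrite /bsum !trap_affine; field. Qed.

Lemma bsum_le f B N x y h : 0 <= h ->
  (forall z, in_sq x y h z -> z = x +i* complex.Im z \/ z = (x + h) +i* complex.Im z \/
     z = complex.Re z +i* y \/ z = complex.Re z +i* (y + h) -> `|f z| <= B) ->
  `|bsum f N x y h| <= B * (4 * h)%:C.
Proof.
move=> h0 fB.
have e (a b c d : R) : `|a +i* b - (c +i* d)| = `|(a - c) +i* (b - d)| by [].
have n1 (a : R) : `|a +i* 0| = `|a|%:C by rewrite normC_real.
have n2 (a : R) : `|0 +i* a| = `|a|%:C.
  by rewrite normc_def/= expr0n/= add0r sqrtr_sqr.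
have hC : `|h| = h by rewrite ger0_norm.
have side (P : C -> Prop) a b : (forall u v, P u -> P v -> P ((u + v) / 2)) ->
    P a -> P b -> `|b - a| = h%:C -> (forall z, P z -> `|f z| <= B) ->
    `|trap f N a b| <= B * h%:C.
  by move=> ? ? ? <- ?; apply: (@trap_le _ P).
have -> : B * (4 * h)%:C = B * h%:C + B * h%:C + B * h%:C + B * h%:C.
  by rewrite rmorphM/= rmorph_nat; ring.
rewrite /bsum.
apply: ler_norm4D.
- apply: (side (fun z => in_sq x y h z /\ complex.Im z = y)).
  + by move=> u v; exact: Im_side_mid.
  + by split=> //; split=> /=; lra.
  + by split=> //; split=> /=; lra.
  + by rewrite e subrr addrAC subrr add0r n1 hC.
  + by move=> [a b] [Qz /= ?]; apply: fB => //=; subst b; auto.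
- apply: (side (fun z => in_sq x y h z /\ complex.Re z = x + h)).
  + by move=> u v; exact: Re_side_mid.
  + by split=> //; split=> /=; lra.
  + by split=> //; split=> /=; lra.
  + by rewrite e subrr addrAC subrr add0r n2 hC.
  + by move=> [a b] [Qz /= ?]; apply: fB => //=; subst a; auto.
- apply: (side (fun z => in_sq x y h z /\ complex.Im z = y + h)).
  + by move=> u v; exact: Im_side_mid.
  + by split=> //; split=> /=; lra.
  + by split=> //; split=> /=; lra.
  + by rewrite e subrr opprD addrA subrr sub0r n1 normrN hC.
  + by move=> [a b] [Qz /= ?]; apply: fB => //=; subst b; auto.
- apply: (side (fun z => in_sq x y h z /\ complex.Re z = x)).
  + by move=> u v; exact: Re_side_mid.
  + by split=> //; split=> /=; lra.
  + by split=> //; split=> /=; lra.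
  + by rewrite e subrr opprD addrA subrr sub0r n2 normrN hC.
  + by move=> [a b] [Qz /= ?]; apply: fB => //=; subst a; auto.
Qed.

Definition locally_bounded f z : Prop :=
  exists B : R, \forall w \near z, `|f w| <= B%:C.

Lemma differentiable_expansion f z : differentiable f z ->
  exists a : C, forall e : R, 0 < e ->
    \forall w \near z, `|f w - f z - a * (w - z)| <= e%:C * `|w - z|.
Proof.
move=> /derivable1_diffP/cvg_ex[a fa]; exists a => e e0.
have e0' : 0 < e%:C by rewrite ltcR.
move: fa => /cvgrPdist_lt/(_ _ e0') => /nbhs_normP[/= d d0 H].
apply/nbhs_normP; exists d => //= w wz.
have [->|wz0] := eqVneq w z; first by rewrite !subrr mulr0 subrr normr0 mulr0.
have wz' : w - z != 0 by rewrite subr_eq0.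
have := H (w - z); rewrite /= sub0r normrN => H'.
have wz2 : `|w - z| < d by rewrite distrC.
have := H' wz2 wz'.
rewrite [_ *: 1]mulr1 subrK => /ltW.
have -> : f w - f z - a * (w - z) =
          - ((a - (w - z)^-1 * (f w - f z)) * (w - z)) by field.
by rewrite normrN normrM => k; exact: ler_pM.
Qed.

(* The number of one-sided neighbourhoods of [e] contained in [[x, x + h]]. Over
   the two coordinates it counts the quadrants at a point lying in a square,
   which is additive under subdivision and positive on the closed square. *)
Definition germs x h (e : R) : R :=
  (x <= e < x + h)%R%:R + (x < e <= x + h)%R%:R.

Lemma germs_split x h e : 0 < h ->
  germs x h e = germs x (h / 2) e + germs (x + h / 2) (h / 2) e.
Proof.
move=> h0; rewrite /germs.
have -> : x + h / 2 + h / 2 = x + h by field.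
have [xm mh] : x < x + h / 2 /\ x + h / 2 < x + h by split; lra.
by have [?|?|?] := ltgtP x e; have [?|?|?] := ltgtP (x + h / 2) e; try lra;
  have [?|?|?] := ltgtP (x + h) e; rewrite /=; lra.
Qed.

Lemma germs_ge0 x h e : 0 <= germs x h e.
Proof. by rewrite addr_ge0. Qed.

Lemma germs_ge1 x h e : 0 < h -> x <= e -> e <= x + h -> 1 <= germs x h e.
Proof.
move=> h0 xe eh; rewrite /germs xe eh andbT /=.
by have [?|?] := ltP e (x + h); have [?|?] := ltP x e => /=; lra.
Qed.

Lemma goursat_squares f (E : seq C) x0 y0 h0 : 0 < h0 ->
  (forall z, in_sq x0 y0 h0 z -> z \notin E -> differentiable f z) ->
  (forall z, z \in E -> locally_bounded f z) ->
  forall eps : R, 0 < eps -> exists N0, forall N, (N0 <= N)%N ->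
    `|bsum f N x0 y0 h0| <= eps%:C.
Proof.
move=> h00 fdiff fbnd eps eps0.
pose m x y h : R :=
  h ^+ 2 + \sum_(e <- E) germs x h (complex.Re e) * germs y h (complex.Im e).
have m_split x y h : 0 < h -> m x y h = m x y (h / 2) + m (x + h / 2) y (h / 2)
    + m x (y + h / 2) (h / 2) + m (x + h / 2) (y + h / 2) (h / 2).
  move=> h_0; rewrite /m.
  rewrite (eq_bigr (fun e =>
    germs x (h / 2) (complex.Re e) * germs y (h / 2) (complex.Im e)
    + germs (x + h / 2) (h / 2) (complex.Re e) * germs y (h / 2) (complex.Im e)
    + germs x (h / 2) (complex.Re e) * germs (y + h / 2) (h / 2) (complex.Im e)
    + germs (x + h / 2) (h / 2) (complex.Re e)
      * germs (y + h / 2) (h / 2) (complex.Im e))); last first.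
    by move=> e _; rewrite germs_split// (@germs_split y)//; ring.
  by rewrite !big_split/=; field.
have sum_ge0 x y h :
    0 <= \sum_(e <- E) germs x h (complex.Re e) * germs y h (complex.Im e).
  by apply: sumr_ge0 => e _; rewrite mulr_ge0// germs_ge0.
suff H : forall e : R, 0 < e -> exists N0, forall N, (N0 <= N)%N ->
    `|bsum f N x0 y0 h0| <= (e * m x0 y0 h0)%:C.
  have m0 : 0 < m x0 y0 h0 by rewrite ltr_pwDl// exprn_gt0.
  have [N0 N0P] := H (eps / m x0 y0 h0) (divr_gt0 eps0 m0).
  by exists N0 => N /N0P; rewrite divfK// gt_eqF.
move=> e e0.
apply: (@cousin_squares _ (fun x y h => exists N0, forall N, (N0 <= N)%N ->
    `|bsum f N x y h| <= (e * m x y h)%:C)) => //.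
  move=> x y h h_0 [N1 H1] [N2 H2] [N3 H3] [N4 H4].
  exists (maxn (maxn N1 N2) (maxn N3 N4)).+1 => -[//|N].
  rewrite ltnS !geq_max => /andP[/andP[l1 l2] /andP[l3 l4]].
  rewrite bsumS m_split// 3!mulrDr 3!rmorphD/=.
  by apply: ler_norm4D; [exact: H1|exact: H2|exact: H3|exact: H4].
move=> z zQ; have [zE|zE] := boolP (z \in E).
  have [B /nearC_ex[d d0 fB]] := fbnd _ zE.
  pose B' := `|B| + 1.
  have B'0 : 0 < B' by rewrite ltr_wpDl.
  exists (Num.min (d / 2) (e / (4 * B'))).
    by rewrite lt_min; apply/andP; split; apply: divr_gt0 => //; rewrite mulr_gt0.
  move=> x y h h_0; rewrite lt_min => /andP[hd he] zQ'; exists 0%N => N _.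
  apply: le_trans (bsum_le (B := B'%:C) N (ltW h_0) _) _.
    move=> w wQ _; apply: le_trans (fB _ _) _.
      apply: le_lt_trans (in_sq_dist zQ' wQ) _.
      by rewrite ltcR mulr2n; lra.
    by rewrite lecR /B' (le_trans (ler_norm _))// lerDl.
  rewrite -rmorphM lecR.
  have h1 : B' * (4 * h) <= e.
    by move: he; rewrite ltr_pdivlMr ?mulr_gt0// => /ltW; lra.
  apply: le_trans h1 _; rewrite ler_pMr//.
  rewrite /m (big_rem _ zE)/=.
  have [a1 a2 b1 b2] := zQ'.
  apply: le_trans (_ : 1 * 1 <= _); first by rewrite mulr1.
  rewrite addrCA ler_wpDr//.
    apply: addr_ge0; first by rewrite exprn_ge0// ltW.
    by apply: sumr_ge0 => u _; rewrite mulr_ge0// germs_ge0.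
  by rewrite ler_pM// germs_ge1.
have [a /(_ (e / 8))] := differentiable_expansion (fdiff _ zQ zE).
move=> /(_ (divr_gt0 e0 (ltr0n _ 8)))/nearC_ex[d d0 H].
exists (d / 2); first by rewrite divr_gt0.
move=> x y h h_0 hd zQ'; exists 0%N => N _.
pose r w := f w - f z - a * (w - z).
have -> : bsum f N x y h = bsum r N x y h.
  rewrite -[RHS]addr0 -[X in _ + X](mulr0 1) -(bsum_affine a (f z - a * z) N x y h).
  rewrite -bsumD; congr bsum; apply/funext => w; rewrite /r; ring.
apply: le_trans (bsum_le (B := ((e / 8) * (h *+ 2))%:C) N (ltW h_0) _) _.
  move=> w wQ _; have wz := in_sq_dist zQ' wQ.
  apply: le_trans (H _ _) _.
    by apply: le_lt_trans wz _; rewrite ltcR mulr2n; lra.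
  by rewrite [leRHS]rmorphM/= ler_wpM2l// ler0c divr_ge0// ltW.
rewrite -rmorphM lecR; apply: le_trans (_ : e * h ^+ 2 <= _).
  by rewrite le_eqVlt; apply/orP; left; apply/eqP; rewrite mulr2n; field.
by rewrite ler_wpM2l ?(ltW e0)// lerDl.
Qed.

End Goursat.

(** * The identity theorem *)

Section Identity.
Local Open Scope complex_scope.
Context (R : realType).
Local Notation C := R[i].
Implicit Types (f g : C -> C) (x y h : R) (z w : C).

Lemma normc_ge_Im z : `|complex.Im z|%:C <= `|z|.
Proof. by rewrite normc_def lecR -sqrtr_sqr ler_wsqrtr// lerDr sqr_ge0. Qed.

Lemma normc_le_ReIm (z : C) (r : R) : `|z| <= r%:C ->
  `|complex.Re z| <= r /\ `|complex.Im z| <= r.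
Proof.
move=> zr; split; rewrite -lecR; first exact: le_trans (normc_ge_Re _) zr.
exact: le_trans (normc_ge_Im _) zr.
Qed.

Lemma normC_ex (z : C) : exists2 r : R, 0 <= r & `|z| = r%:C.
Proof.
exists (complex.Re `|z|); last by rewrite RRe_real// normr_real.
by rewrite normc_def/= sqrtr_ge0.
Qed.

Lemma square_bounded f x0 y0 h0 : 0 < h0 ->
  (forall z, in_sq x0 y0 h0 z -> {for z, continuous f}) ->
  exists M : R, forall z, in_sq x0 y0 h0 z -> `|f z| <= M%:C.
Proof.
move=> h00 fc.
apply: (@cousin_squares _ (fun x y h => exists M : R, forall z,
  in_sq x y h z -> `|f z| <= M%:C)) => //.
  move=> x y h h_0 [M1 H1] [M2 H2] [M3 H3] [M4 H4].
  exists (Num.max (Num.max M1 M2) (Num.max M3 M4)) => z [a1 a2 b1 b2].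
  have lemax (M M' : R) : `|f z| <= M%:C -> M <= M' -> `|f z| <= M'%:C.
    by move=> /le_trans + MM'; apply; rewrite lecR.
  have [c1|c1] := leP (complex.Re z) (x + h / 2);
    have [c2|c2] := leP (complex.Im z) (y + h / 2).
  - by apply: lemax (H1 _ _) _; [split|rewrite !le_max lexx].
  - by apply: lemax (H3 _ _) _; [split; lra|rewrite !le_max lexx !orbT].
  - by apply: lemax (H2 _ _) _; [split; lra|rewrite !le_max lexx !orbT].
  - by apply: lemax (H4 _ _) _; [split; lra|rewrite !le_max lexx !orbT].
move=> z /fc /cvgrPdist_lt/(_ 1 ltr01)/nearC_ex[d d0 H].
exists (d / 2); first by rewrite divr_gt0.
have [r _ r0] := normC_ex (f z).
move=> x y h h_0 hd zQ; exists (r + 1) => w wQ.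
rewrite rmorphD/= -r0 -lerBlDl (le_trans (lerB_dist _ _))// distrC ltW// H//.
by apply: le_lt_trans (in_sq_dist zQ wQ) _; rewrite ltcR mulr2n; lra.
Qed.

Lemma trap_Im_ge (P : C -> Prop) f (k : R) N a b :
  (forall u v, P u -> P v -> P ((u + v) / 2)) -> P a -> P b ->
  (forall z, P z -> k <= complex.Im (f z * (b - a))) ->
  k <= complex.Im (trap f N a b).
Proof.
move=> Pmid; have ImD (u v : C) : complex.Im (u + v) = complex.Im u + complex.Im v.
  by case: u v => [? ?] [? ?].
have ImH (u : C) : complex.Im (u / 2) = complex.Im u / 2.
  rewrite -[u]addr0 -[in LHS](mulr0 0) (ReIm_mid u (0 * 0)).2 mulr0 addr0/=.
  by rewrite addr0.
elim: N a b k => [|N IH] a b k Pa Pb fk /=.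
  rewrite mulrAC ImH mulrDl ImD.
  by have := fk _ Pa; have := fk _ Pb; lra.
rewrite ImD; have Pm := Pmid _ _ Pa Pb.
have -> : k = k / 2 + k / 2 by field.
apply: lerD; apply: IH => // z Pz.
- have -> : f z * ((a + b) / 2 - a) = f z * (b - a) / 2 by field.
  by rewrite ImH; have := fk _ Pz; lra.
- have -> : f z * (b - (a + b) / 2) = f z * (b - a) / 2 by field.
  by rewrite ImH; have := fk _ Pz; lra.
Qed.

Lemma Im_div (a b c d : R) : complex.Im ((a +i* b)^-1 * (c +i* d)) =
  (d * a - c * b) / (a ^+ 2 + b ^+ 2).
Proof. by rewrite /=; ring. Qed.

Lemma bsum_inv N (z0 : C) : `|z0| <= (1 / 8 : R)%:C ->
  1 <= `|bsum (fun z => (z - z0)^-1) N (-1) (-1) 2|.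
Proof.
case: z0 => p q /normc_le_ReIm/= [].
rewrite !ler_norml => /andP[p1 p2] /andP[q1 q2].
apply: le_trans (normc_ge_Im _); rewrite -[1]/((1 : R)%:C) lecR.
apply: le_trans (ler_norm _).
have e1 : (1 : R) = 1 / 4 + 1 / 4 + 1 / 4 + 1 / 4 by field.
rewrite [leLHS]e1 {e1}.
have ImD (u v : C) : complex.Im (u + v) = complex.Im u + complex.Im v.
  by case: u v => [? ?] [? ?].
have quot (a b c d : R) : 0 < a ^+ 2 + b ^+ 2 ->
    a ^+ 2 + b ^+ 2 <= 4 * (d * a - c * b) ->
    1 / 4 <= complex.Im ((a +i* b)^-1 * (c +i* d)).
  by move=> h1 h2; rewrite Im_div ler_pdivlMr//; lra.
rewrite /bsum !ImD !lerD//.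
- apply: (trap_Im_ge (P := fun z => in_sq (-1) (-1) 2 z /\ complex.Im z = -1)).
  + by move=> u v; exact: Im_side_mid.
  + by split=> //; split=> /=; lra.
  + by split=> //; split=> /=; lra.
  + by move=> [u v] [[/= ? ? _ _] ->]; apply: quot; nra.
- apply: (trap_Im_ge (P := fun z => in_sq (-1) (-1) 2 z /\ complex.Re z = 1)).
  + by move=> u v; exact: Re_side_mid.
  + by split=> /=; [split=> /=; lra|lra].
  + by split=> /=; [split=> /=; lra|lra].
  + by move=> [u v] [[/= _ _ ? ?] ->]; apply: quot; nra.
- apply: (trap_Im_ge (P := fun z => in_sq (-1) (-1) 2 z /\ complex.Im z = 1)).
  + by move=> u v; exact: Im_side_mid.
  + by split=> /=; [split=> /=; lra|lra].
  + by split=> /=; [split=> /=; lra|lra].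
  + by move=> [u v] [[/= ? ? _ _] ->]; apply: quot; nra.
- apply: (trap_Im_ge (P := fun z => in_sq (-1) (-1) 2 z /\ complex.Re z = -1)).
  + by move=> u v; exact: Re_side_mid.
  + by split=> //; split=> /=; lra.
  + by split=> //; split=> /=; lra.
  + by move=> [u v] [[/= _ _ ? ?] ->]; apply: quot; nra.
Qed.

Lemma locally_boundedM f g z : locally_bounded f z -> locally_bounded g z ->
  locally_bounded (fun w => f w * g w) z.
Proof.
move=> [A fA] [B gB]; exists (A * B); near=> w.
rewrite normrM rmorphM/= ler_pM//; [near: w; exact: fA|near: w; exact: gB].
Unshelve. all: by end_near. Qed.

Lemma eq_locally_bounded f g z : f =1 g -> locally_bounded f z ->
  locally_bounded g z.
Proof. by move=> /funext ->. Qed.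

Lemma continuous_locally_bounded f z : {for z, continuous f} ->
  locally_bounded f z.
Proof.
move=> /cvgrPdist_lt/(_ 1 ltr01) H; have [r _ fr] := normC_ex (f z).
exists (r + 1); near=> w.
rewrite rmorphD/= -fr -lerBlDl (le_trans (lerB_dist _ _))// distrC ltW//.
by near: w.
Unshelve. all: by end_near. Qed.

Lemma difference_quotient_locally_bounded f z : differentiable f z ->
  locally_bounded (fun w => (f w - f z) / (w - z)) z.
Proof.
move=> /differentiable_expansion[a /(_ 1 ltr01) H].
have [r r0 ar] := normC_ex a; exists (r + 1); near=> w.
rewrite rmorphD/= -ar.
have [->|wz] := eqVneq w z; first by rewrite !subrr mul0r normr0 addr_ge0.
have wz0 : w - z != 0 by rewrite subr_eq0.
have -> : (f w - f z) / (w - z) = a + (f w - f z - a * (w - z)) / (w - z).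
  by field.
rewrite (le_trans (ler_normD _ _))// lerD// normrM normfV.
rewrite ler_pdivrMr ?normr_gt0//; near: w; exact: H.
Unshelve. all: by end_near. Qed.


Lemma locally_boundedD f g z : locally_bounded f z -> locally_bounded g z ->
  locally_bounded (fun w => f w + g w) z.
Proof.
move=> [A fA] [B gB]; exists (A + B); near=> w.
rewrite rmorphD/= (le_trans (ler_normD _ _))// lerD//.
  by near: w; exact: fA.
by near: w; exact: gB.
Unshelve. all: by end_near. Qed.

Lemma differentiable_id (V : normedModType C) (v : V) : differentiable id v.
Proof. by apply: (@linear_differentiable _ _ _ idfun) => ?. Qed.

Lemma differentiable_hornerC (p : {poly C}) z : differentiable (horner p) z.
Proof.
elim/poly_ind: p => [|p c IH].
  have -> : horner (0 : {poly C}) = cst 0 by apply/funext => w; rewrite horner0.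
  exact: differentiable_cst.
have -> : horner (p * 'X + c%:P) = (fun w => p.[w] * w + c).
  by apply/funext => w; rewrite !hornerE.
apply: differentiableD; last exact: differentiable_cst.
by apply: differentiableM => //; exact: differentiable_id.
Qed.

Lemma differentiable_subc (a : C) z : differentiable (fun w => w - a) z.
Proof.
by apply: differentiableB; [exact: differentiable_id|exact: differentiable_cst].
Qed.

Lemma locally_bounded_diff f z : differentiable f z -> locally_bounded f z.
Proof. by move=> /differentiable_continuous/continuous_locally_bounded. Qed.

(* Dividing [f] by [k] of its zeros close to the centre gains a factor [2 ^ k]
   in the Cauchy estimate. *)
Lemma divided_estimate f (z0 : C) (M : R) (k : nat) (xs : nat -> R) :
  (forall z, in_sq (-1) (-1) 2 z -> differentiable f z) ->
  (forall z, in_sq (-1) (-1) 2 z -> `|f z| <= M%:C) ->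
  `|z0| <= (1 / 8 : R)%:C ->
  (forall j, `|xs j| <= 1 / 8) -> injective xs ->
  (forall j, f (xs j)%:C = 0) -> (forall j, (xs j)%:C != z0) ->
  `|f z0| <= ((16 * M + 1) / 2 ^+ k)%:C.
Proof.
move=> fd fM z0s xss xsI fxs xsz0.
pose p : {poly C} := \prod_(j < k) ('X - (xs j)%:C%:P).
have pE w : p.[w] = \prod_(j < k) (w - (xs j)%:C).
  by rewrite /p horner_prod; apply: eq_bigr => j _; rewrite !hornerE.
pose E := z0 :: [seq (xs j)%:C | j <- iota 0 k].
have smallC (j : nat) : `|(xs j)%:C| <= (1 / 8 : R)%:C :> C.
  by rewrite normC_real lecR.
have insq (a : C) : `|a| <= (1 / 8 : R)%:C -> in_sq (-1) (-1) 2 a.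
  by move=> /normc_le_ReIm[]; rewrite !ler_norml => /andP[? ?] /andP[? ?]; split; lra.
have p0 w : w \notin E -> p.[w] != 0.
  rewrite inE negb_or => /andP[_ wE].
  rewrite pE; apply/prodf_neq0 => j _; rewrite subr_eq0.
  by apply: contra wE => /eqP ->; apply: map_f; rewrite mem_iota/= add0n.
have pz0 : p.[z0] != 0.
  by rewrite pE; apply/prodf_neq0 => j _; rewrite subr_eq0 eq_sym.
pose F w := f w * (p.[w])^-1.
pose A := F z0.
have Fd z : in_sq (-1) (-1) 2 z -> p.[z] != 0 -> differentiable F z.
  move=> zQ pz; apply: differentiableM; first exact: fd.
  by apply: differentiableV => //; exact: differentiable_hornerC.
have invd z : z != z0 -> differentiable (fun w => (w - z0)^-1) z.
  move=> zz0; apply: differentiableV; last by rewrite subr_eq0.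
  exact: differentiable_subc.
pose G w := F w * (w - z0)^-1 + - A * (w - z0)^-1.
have Gd z : in_sq (-1) (-1) 2 z -> z \notin E -> differentiable G z.
  move=> zQ zE; have zz0 : z != z0 by move: zE; rewrite inE negb_or => /andP[].
  apply: differentiableD; last first.
    by apply: differentiableM; [exact: differentiable_cst|exact: invd].
  by apply: differentiableM; [apply: Fd => //; exact: p0|exact: invd].
have Gb z : z \in E -> locally_bounded G z.
  rewrite inE; have [-> _|zz0 /=] := eqVneq z z0.
    apply: eq_locally_bounded (difference_quotient_locally_bounded (Fd z0 _ pz0)).
      by move=> w; rewrite /G mulrBl mulNr.
    exact: insq.
  move=> /mapP[m]; rewrite mem_iota/= add0n => mk zm.
  apply: locally_boundedD; last first.
    apply: locally_bounded_diff; apply: differentiableM; last exact: invd.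
    exact: differentiable_cst.
  apply: locally_boundedM; last by apply: locally_bounded_diff; exact: invd.
  pose q : {poly C} := \prod_(j < k | j != Ordinal mk) ('X - (xs j)%:C%:P).
  have pq w : p.[w] = (w - z) * q.[w].
    by rewrite /p (bigD1 (Ordinal mk))//= hornerM !hornerE zm.
  have qz : q.[z] != 0.
    rewrite /q horner_prod; apply/prodf_neq0 => j ji; rewrite !hornerE subr_eq0 zm.
    by apply: contra ji => /eqP/complexI/xsI e; apply/eqP/val_inj.
  apply: (@eq_locally_bounded (fun w => (f w - f z) / (w - z) * (q.[w])^-1)).
    by move=> w; rewrite /F pq zm fxs subr0 invfM mulrA.
  apply: locally_boundedM.
    apply: difference_quotient_locally_bounded; apply: fd; rewrite zm; exact: insq.
  apply: locally_bounded_diff; apply: differentiableV => //.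
  exact: differentiable_hornerC.
have [N0 /(_ N0 (leqnn _))] :=
  goursat_squares (ltr0n _ 2) Gd Gb ltr01.
rewrite /G bsumD => HG.
have far (z a : C) : in_sq (-1) (-1) 2 z -> z = -1 +i* complex.Im z \/
      z = (-1 + 2) +i* complex.Im z \/ z = complex.Re z +i* -1 \/
      z = complex.Re z +i* (-1 + 2) ->
    `|a| <= (1 / 8 : R)%:C -> (1 / 2 : R)%:C <= `|z - a|.
  move=> _ zb /normc_le_ReIm; case: a => a b /=.
  rewrite !ler_norml => -[/andP[a1 a2] /andP[b1 b2]].
  case: zb => [->|[->|[->|->]]].
  - apply: le_trans (normc_ge_Re _); rewrite lecR/= ler_normr; apply/orP; right; lra.
  - apply: le_trans (normc_ge_Re _); rewrite lecR/= ler_normr; apply/orP; left; lra.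
  - apply: le_trans (normc_ge_Im _); rewrite lecR/= ler_normr; apply/orP; right; lra.
  - apply: le_trans (normc_ge_Im _); rewrite lecR/= ler_normr; apply/orP; left; lra.
have inv2 (u : C) : (1 / 2 : R)%:C <= `|u| -> `|u^-1| <= 2%:C.
  move=> h; have h0 : 0 < `|u| by apply: lt_le_trans h; rewrite ltcR; lra.
  rewrite normfV invf_ple ?posrE//; last by rewrite ltcR.
  apply: le_trans _ h.
  by rewrite -(fmorphV (real_complex R)) lecR; lra.
have M0 : 0 <= M.
  by rewrite -ler0c (le_trans _ (fM z0 (insq _ z0s))).
have HF : `|bsum (fun w => F w * (w - z0)^-1) N0 (-1) (-1) 2| <=
    (M * 2 ^+ k * 2)%:C * (4 * 2)%:C.
  apply: bsum_le => // z zQ zb.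
  rewrite !normrM [X in _ <= X]rmorphM/= ler_pM ?mulr_ge0//; last first.
    by apply: inv2; apply: far.
  rewrite rmorphM/= ler_pM//; first exact: fM.
  rewrite normfV pE normr_prod -prodfV.
  apply: le_trans (_ : \prod_(j < k) (2 : R)%:C <= _).
    apply: ler_prod => j _; rewrite invr_ge0 normr_ge0/= -normfV.
    by apply: inv2; apply: far.
  by rewrite prodr_const card_ord rmorphXn.
have HA : `|A| <= ((16 * M + 1) * 2 ^+ k)%:C.
  apply: le_trans (_ : `|A| * 1 <= _); first by rewrite mulr1.
  apply: le_trans (ler_wpM2l (normr_ge0 _) (bsum_inv N0 z0s)) _.
  rewrite -normrM.
  set u := bsum _ _ _ _ _ in HG HF; set v := bsum _ _ _ _ _ in HG *.
  have -> : A * v = u - (u + - A * v) by ring.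
  apply: le_trans (ler_normB _ _) _; apply: le_trans (lerD HF HG) _.
  rewrite -rmorphM -rmorphD lecR/=.
  have -> : (16 * M + 1) * 2 ^+ k = M * 2 ^+ k * 2 * (4 * 2) + 2 ^+ k by ring.
  by rewrite lerD2l exprn_ege1// ler1n.
have -> : f z0 = A * p.[z0] by rewrite /A /F divfK.
have HP : `|p.[z0]| <= ((1 / 4) ^+ k)%:C.
  rewrite pE normr_prod rmorphXn/=.
  apply: le_trans (_ : \prod_(j < k) (1 / 4 : R)%:C <= _).
    apply: ler_prod => j _; rewrite normr_ge0/=.
    apply: le_trans (ler_normB _ _) (le_trans (lerD z0s (smallC j)) _).
    by rewrite -rmorphD lecR/=; lra.
  by rewrite prodr_const card_ord.
rewrite normrM; apply: le_trans (ler_pM _ _ HA HP) _ => //.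
rewrite -rmorphM lecR -mulrA -exprMn -exprVn.
by rewrite (_ : 2 * (1 / 4) = 2^-1 :> R) ?lexx//; field.
Qed.

Lemma small_identity f (d : R) : 0 < d ->
  (forall z, in_sq (-1) (-1) 2 z -> differentiable f z) ->
  (forall x : R, 0 < x < d -> f x%:C = 0) ->
  forall z0 : C, `|z0| <= (1 / 8 : R)%:C -> f z0 = 0.
Proof.
move=> d0 fd f0 z0 z0s.
have [[x xd ->]|nreal] := pselect (exists2 x : R, 0 < x < d & z0 = x%:C).
  exact: f0.
have [M fM] := square_bounded (ltr0n _ 2)
  (fun z zQ => differentiable_continuous (fd z zQ)).
pose c := Num.min d (1 / 8).
have c0 : 0 < c by rewrite lt_min d0/=; lra.
pose xs (j : nat) := c / (j.+2)%:R.
have xs0 j : 0 < xs j by rewrite divr_gt0.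
have xsc j : xs j < c by rewrite ltr_pdivrMr// ltr_pMr// ltr1n.
have xsd j : 0 < xs j < d.
  by rewrite xs0 (lt_le_trans (xsc j))// ge_min lexx.
have xsI : injective xs.
  move=> i j /mulfI; rewrite gt_eqF// => /(_ isT)/invr_inj/eqP.
  by rewrite eqr_nat => /eqP [].
have est k : `|f z0| <= ((16 * M + 1) / 2 ^+ k)%:C.
  apply: (@divided_estimate f z0 M k xs) => //.
  - move=> j; rewrite gtr0_norm// ltW// (lt_le_trans (xsc j))//.
    by rewrite ge_min lexx orbT.
  - by move=> j; exact: f0.
  - by move=> j; apply/eqP => e; apply: nreal; exists (xs j).
have [r r0 fr] := normC_ex (f z0).
have {}est k : r * 2 ^+ k <= 16 * M + 1.
  by have := est k; rewrite fr lecR ler_pdivlMr// exprn_gt0.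
apply/eqP; rewrite -normr_eq0 fr -[0]/((0 : R)%:C) (inj_eq (@complexI _)).
apply/negPn/negP => rn0; have {rn0} rp : 0 < r by rewrite lt_neqAle eq_sym rn0.
have B0 : 0 <= (16 * M + 1) / r.
  by rewrite divr_ge0// (le_trans _ (est 0%N))// mulr_ge0.
have := archi_boundP B0; rewrite ltr_pdivrMr//; set N := Num.bound _ => HN.
have := le_lt_trans (est N) HN; rewrite [ltRHS]mulrC ltr_pM2l// -natrX ltr_nat.
by rewrite ltnNge => /negP; apply; rewrite ltnW// ltn_expl.
Qed.

Lemma identity_disc f (r d : R) : 0 < r -> 0 < d ->
  (forall z, `|z| <= (16 * r)%:C -> differentiable f z) ->
  (forall x : R, 0 < x < d -> f x%:C = 0) ->
  forall z, `|z| <= r%:C -> f z = 0.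
Proof.
move=> r0 d0 fd f0 z zr.
have r8C : (8 * r)%:C != 0.
  by rewrite -[0]/((0 : R)%:C) (inj_eq (@complexI _)) mulf_neq0// gt_eqF.
have -> : z = (8 * r)%:C * (z / (8 * r)%:C) by rewrite mulrC divfK.
have r8 : 0 < 8 * r by rewrite mulr_gt0.
apply: (@small_identity (fun w => f ((8 * r)%:C * w)) (d / (8 * r))).
- exact: divr_gt0.
- move=> w [? ? ? ?]; apply: (@differentiable_comp _ _ _ _ (fun w => (8 * r)%:C * w) f).
    by apply: differentiableM; [exact: differentiable_cst|exact: differentiable_id].
  apply: fd; rewrite normrM normC_real (gtr0_norm r8).
  have r8c : 0 <= (8 * r)%:C by rewrite ler0c ltW.
  apply: le_trans (ler_wpM2l r8c (norm_le_ReIm w)) _.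
  rewrite -rmorphM lecR (_ : 16 * r = 8 * r * 2); last by ring.
  rewrite ler_wpM2l ?(ltW r8)// (_ : 2 = 1 + 1 :> R)// lerD// ler_norml; lra.
- move=> x /andP[x0 xd]; rewrite -rmorphM f0// mulr_gt0//=.
  by move: xd; rewrite ltr_pdivlMr// mulrC.
- rewrite normrM normfV normC_real (gtr0_norm r8) ler_pdivrMr ?ltcR//.
  by rewrite -rmorphM (le_trans zr)// lecR; lra.
Qed.

End Identity.

(** * Pullbacks of restriction algebras *)

Definition unique_extension (K : numFieldType) (X : Type) (Y : topologicalType)
    (O : funalg K Y) (D : X -> Y) : Prop :=
  forall f g : Y -> K, O f -> O g -> f \o D = g \o D -> f = g.

Section Pullback.
Context (K : numFieldType).

Lemma extensionP (X : Type) (Y : topologicalType) (O : funalg K Y) (D : X -> Y)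
    (f : restriction_alg O D) :
  O (extension f) /\ f = extension f \o D :> (X -> K).
Proof. exact: (projT2 (cid (restriction_algP f))). Qed.

Lemma extension_unique (X : Type) (Y : topologicalType) (O : funalg K Y)
    (D : X -> Y) (f : restriction_alg O D) (g : Y -> K) :
  unique_extension O D -> O g -> f = g \o D :> (X -> K) -> extension f = g.
Proof.
move=> uniq Og fg; have [Of fE] := extensionP f.
by apply: uniq => //; rewrite -fE fg.
Qed.

Lemma precomp_continuous (Y Y' : topologicalType) (phi : Y' -> Y) :
  continuous phi ->
  continuous ((fun f : Y -> K => f \o phi) :
    {family compact, Y -> K} -> {family compact, Y' -> K}).
Proof.
move=> cphi f.
pose F : set_system (Y' -> K) :=
  (fun g : Y -> K => g \o phi) @ nbhs (f : {family compact, Y -> K}).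
have FF : Filter F by apply: fmap_filter.
suff H : forall A : set Y', compact A -> {uniform A, F --> (f \o phi : Y' -> K)}.
  exact: (iffRL (@fam_cvgP Y' K compact F (f \o phi) FF) H).
move=> A cA P /uniform_nbhs[E [entE EP]].
have cphiA : compact (phi @` A).
  by apply: continuous_compact => //; exact: continuous_subspaceT.
have := @fam_nbhs _ _ compact _ _ f entE cphiA.
by apply: filterS => g Hg; apply: EP => y Ay /=; apply: Hg; exists y.
Qed.

Section Map.
Context (X X' : Type) (Y Y' : topologicalType) (O : funalg K Y)
  (O' : funalg K Y') (D : X -> Y) (D' : X' -> Y').
Context (phi : Y' -> Y) (Ophi : forall f, O f -> O' (f \o phi)).

Lemma pullback_subproof (f : restriction_alg O D) :
  (extension f \o phi \o D' : X' -> K^o) \in restriction_pred O' D'.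
Proof.
apply/asboolP; exists (extension f \o phi) => //; apply: Ophi.
by have [] := extensionP f.
Qed.

Definition pullback (f : restriction_alg O D) : restriction_alg O' D' :=
  RestrictionAlg (pullback_subproof f).

Context (uniq : unique_extension O D) (uniq' : unique_extension O' D').

Lemma pullbackE (fhat : Y -> K) (f : restriction_alg O D) : O fhat ->
  f = fhat \o D :> (X -> K) -> pullback f = fhat \o phi \o D' :> (X' -> K).
Proof. by move=> Of fE; rewrite /= (extension_unique uniq Of fE). Qed.

Lemma extension_pullback (f : restriction_alg O D) :
  extension (pullback f) = extension f \o phi.
Proof.
by apply: extension_unique => //; apply: Ophi; have [] := extensionP f.
Qed.

Lemma pullback_continuous : continuous phi -> continuous pullback.
Proof.
move=> cphi; apply: continuous_comp_initial.
have -> : extension \o pullback = (fun f => f \o phi) \o extension.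
  by apply/funext => f; exact: extension_pullback.
move=> f; apply: (@continuous_comp _ _ _ extension).
  exact: initial_continuous.
exact: precomp_continuous.
Qed.

Lemma pullback_linear : linear pullback.
Proof.
move=> a f g; apply/val_inj; rewrite /=.
have [Of fE] := extensionP f; have [Og gE] := extensionP g.
rewrite (@extension_unique _ _ _ _ (a *: f + g)
  (fun y => a * extension f y + extension g y)) //.
  by apply: funalg_add => //; exact: funalg_scale.
by apply/funext => x /=; rewrite [in LHS]fE [in LHS]gE.
Qed.

Lemma pullback_monoid_morphism : monoid_morphism pullback.
Proof.
split.
  apply/val_inj; rewrite /= (@extension_unique _ _ _ _ 1 (cst 1)) //.
  exact: funalg_one.
move=> f g; apply/val_inj; rewrite /=.
have [Of fE] := extensionP f; have [Og gE] := extensionP g.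
rewrite (@extension_unique _ _ _ _ (f * g)
  (fun y => extension f y * extension g y)) //.
  exact: funalg_mul.
by apply/funext => x /=; rewrite [in LHS]fE [in LHS]gE.
Qed.

End Map.

Lemma pullbackK (X X' : Type) (Y Y' : topologicalType) (O : funalg K Y)
    (O' : funalg K Y') (D : X -> Y) (D' : X' -> Y')
    (phi : Y' -> Y) (psi : Y -> Y')
    (Ophi : forall f, O f -> O' (f \o phi))
    (Opsi : forall f, O' f -> O (f \o psi)) :
  unique_extension O' D' -> cancel psi phi ->
  cancel (@pullback _ _ _ _ _ _ D D' phi Ophi)
         (@pullback _ _ _ _ _ _ D' D psi Opsi).
Proof.
move=> uniq' psiK f; apply/val_inj; rewrite /= extension_pullback//.
have [_ fE] := extensionP f.
by rewrite [RHS]fE; apply/funext => x /=; rewrite psiK.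
Qed.

Lemma pullback_isomorphism (X X' : Type) (Y Y' : topologicalType)
    (O : funalg K Y) (O' : funalg K Y') (D : X -> Y) (D' : X' -> Y')
    (phi : Y' -> Y) (psi : Y -> Y')
    (Ophi : forall f, O f -> O' (f \o phi))
    (Opsi : forall f, O' f -> O (f \o psi)) :
  unique_extension O D -> unique_extension O' D' ->
  cancel phi psi -> cancel psi phi -> continuous phi -> continuous psi ->
  homeomorphic_alg_isomorphism (@pullback _ _ _ _ _ _ D D' phi Ophi).
Proof.
move=> uniq uniq' phiK psiK cphi cpsi; split.
- exact: pullback_linear.
- exact: pullback_monoid_morphism.
- exists (@pullback _ _ _ _ _ _ D' D psi Opsi); split.
  + exact: pullbackK.
  + exact: pullbackK.
  + exact: pullback_continuous.
  + exact: pullback_continuous.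
Qed.

End Pullback.

(** * Entire functions *)

Section Entire.
Context (R : realType) (n : nat).
Local Notation C := R[i].
Local Notation V := 'cV[C]_n.+1.
Local Notation V2 := (V * V)%type.

Definition diag_scale (c : 'rV[C]_n.+1) (p : V2) : V2 :=
  (diag_mx c *m p.1, diag_mx c *m p.2).

Lemma diag_scaleK (c d : 'rV[C]_n.+1) :
  (forall k, d 0 k * c 0 k = 1) -> cancel (diag_scale c) (diag_scale d).
Proof.
move=> dc [xi eta]; rewrite /diag_scale /= !mulmxA mulmx_diag.
rewrite (_ : \row_j _ = const_mx 1) ?diag_const_mx ?mul1mx//.
by apply/rowP => k; rewrite !mxE dc.
Qed.

Lemma differentiable_diag_mx (c : 'rV[C]_n.+1) (v : V) :
  differentiable (fun w : V => diag_mx c *m w) v.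
Proof.
have -> : (fun w : V => diag_mx c *m w) =
    \sum_(k < n.+1) (fun w : V => w k 0 *: (c 0 k *: delta_mx k 0 : V)).
  apply/funext => w; rewrite fct_sumE; apply/colP => k.
  rewrite mul_diag_mx mxE summxE (bigD1 k)//= big1 ?addr0.
    by rewrite !mxE !eqxx mulr1 mulrC.
  by move=> j jk; rewrite !mxE eq_sym (negbTE jk)/= !mulr0.
apply: differentiable_sum => k; apply: differentiableZl.
exact: differentiable_coord.
Qed.

Lemma differentiable_fst (p : V2) : differentiable (fst : V2 -> V) p.
Proof. by apply: (@linear_differentiable _ _ _ fst) => q; exact: cvg_fst. Qed.

Lemma differentiable_snd (p : V2) : differentiable (snd : V2 -> V) p.
Proof. by apply: (@linear_differentiable _ _ _ snd) => q; exact: cvg_snd. Qed.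

Lemma differentiable_diag_scale (c : 'rV[C]_n.+1) (p : V2) :
  differentiable (diag_scale c) p.
Proof.
apply: differentiable_pair.
  apply: (@differentiable_comp _ _ _ _ fst (fun w : V => diag_mx c *m w)).
    exact: differentiable_fst.
  exact: differentiable_diag_mx.
apply: (@differentiable_comp _ _ _ _ snd (fun w : V => diag_mx c *m w)).
  exact: differentiable_snd.
exact: differentiable_diag_mx.
Qed.

Lemma differentiable_line (p q : V2) (t : C) :
  differentiable (fun t : C => p + t *: q) t.
Proof.
apply: differentiableD; first exact: differentiable_cst.
by apply: differentiableZl; exact: differentiable_id.
Qed.

Definition re_part (p : V2) : V := 2^-1 *: (p.1 + conjv p.2).
Definition im_part (p : V2) : V := (2 * 'i)^-1 *: (p.1 - conjv p.2).

Lemma Delta_re_im (p : V2) : p = Delta (re_part p) + 'i *: Delta (im_part p).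
Proof.
have i0 := neq0Ci C.
case: p => xi eta; rewrite /Delta /re_part /im_part /=; congr pair.
  by apply/colP => k; rewrite !mxE; field.
apply/colP => k; rewrite !mxE !(rmorphM, rmorphD, rmorphN, fmorphV) /=.
rewrite conjCK conjCi rmorph1.
by field; rewrite i0.
Qed.

Lemma Delta_real_line (p q : V) (x : R) :
  Delta p + (x%:C)%C *: Delta q = Delta (p + (x%:C)%C *: q).
Proof.
rewrite /Delta /=; congr pair; apply/colP => k; rewrite !mxE rmorphD rmorphM/=.
by rewrite (_ : Num.conj (x%:C)%C = (x%:C)%C)//; apply/CrealP/complex_realP; exists x.
Qed.

Lemma entire_unique_extension :
  unique_extension (entire V2) (@Delta R n).
Proof.
move=> f g fe ge fg; apply/funext => p; rewrite [p]Delta_re_im.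
set P := re_part p; set Q := im_part p.
apply/eqP; rewrite -subr_eq0; apply/eqP.
pose h (t : C) := f (Delta P + t *: Delta Q) - g (Delta P + t *: Delta Q).
suff : h 'i = 0 by [].
apply: (@identity_disc _ h 1 1).
- exact: ltr01.
- exact: ltr01.
- move=> z _; apply: differentiableB.
    apply: (@differentiable_comp _ _ _ _ (fun t : C => Delta P + t *: Delta Q) f).
      exact: differentiable_line.
    exact: fe.
  apply: (@differentiable_comp _ _ _ _ (fun t : C => Delta P + t *: Delta Q) g).
    exact: differentiable_line.
  exact: ge.
- move=> x _; rewrite /h Delta_real_line; apply/eqP; rewrite subr_eq0; apply/eqP.
  exact: (congr1 (@^~ (P + (x%:C)%C *: Q)) fg).
- by rewrite normCi; exact: lexx.
Qed.

Lemma entire_comp (phi : V2 -> V2) : (forall p, differentiable phi p) ->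
  forall f, entire V2 f -> entire V2 (f \o phi).
Proof. by move=> dphi f fe p _; apply: differentiable_comp; [|exact: fe]. Qed.

Definition wrow (s : nat) : 'rV[C]_n.+1 := \row_k if (k < s)%N then 1 else 'i.
Definition wrowV (s : nat) : 'rV[C]_n.+1 := \row_k (wrow s 0 k)^-1.

Lemma WWE s : WW s = diag_scale (wrow s).
Proof. by []. Qed.

Lemma wrow_neq0 s k : wrow s 0 k != 0.
Proof. by rewrite mxE; case: ifP => _; rewrite ?oner_neq0// neq0Ci. Qed.

Lemma WWK s : cancel (WW s) (diag_scale (wrowV s)).
Proof. by apply: diag_scaleK => k; rewrite mxE mulVf// wrow_neq0. Qed.

Lemma WWVK s : cancel (diag_scale (wrowV s)) (WW s).
Proof. by apply: diag_scaleK => k; rewrite [in X in _ * X]mxE mulfV// wrow_neq0. Qed.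

Lemma U1_extension (f : A_V R n) (u : C) (p : V2) : `|u| = 1 -> A_V_U1 f ->
  extension f (u *: p.1, u^-1 *: p.2) = extension f p.
Proof.
move=> u1 fU; have [fe fE] := extensionP f.
pose rot (p : V2) : V2 := (u *: p.1, u^-1 *: p.2).
have rotd q : differentiable rot q.
  apply: differentiable_pair.
    by apply: differentiableZ; exact: differentiable_fst.
  by apply: differentiableZ; exact: differentiable_snd.
have : extension f \o rot = extension f.
  apply: entire_unique_extension => //; first exact: entire_comp.
  rewrite -fE; apply/funext => rho /=; rewrite -(fU u rho u1) [in RHS]fE /=.
  congr extension; rewrite /Delta /rot /=; congr pair.
  rewrite /conjv map_mxZ; congr (_ *: _).
  by rewrite invC_norm u1 expr1n invr1 mul1r.
by move/(congr1 (@^~ p)).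
Qed.

Lemma pullback_U1 (c : 'rV[C]_n.+1) Ophi (f : A_V R n) : A_V_U1 f ->
  A_V_U1 (@pullback _ _ _ _ _ _ _ _ _ (diag_scale c) Ophi f : A_V R n).
Proof.
move=> fU u rho u1 /=; rewrite -[RHS](U1_extension _ u1 fU).
congr extension; rewrite /diag_scale /Delta /=.
have -> : conjv (u *: rho) = u^-1 *: conjv rho.
  rewrite /conjv map_mxZ; congr (_ *: _).
  by rewrite invC_norm u1 expr1n invr1 mul1r.
by rewrite -!scalemxAr.
Qed.

Lemma wick_rotation_exists (s : nat) : exists Phi : A_V R n -> A_V R n,
    [/\ is_wick_rotation s Phi,
        homeomorphic_alg_isomorphism Phi &
        set_bij (@A_V_U1 R n) (@A_V_U1 R n) Phi].
Proof.
have uniq := entire_unique_extension.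
pose O1 := entire_comp (differentiable_diag_scale (wrow s)).
pose O2 := entire_comp (differentiable_diag_scale (wrowV s)).
pose Phi : A_V R n -> A_V R n := pullback (@Delta R n) O1.
pose Psi : A_V R n -> A_V R n := pullback (@Delta R n) O2.
exists Phi; split.
- by move=> fhat f fe fE rho; rewrite /Phi (pullbackE _ O1 uniq fe fE).
- apply: (@pullback_isomorphism _ _ _ _ _ _ _ _ _ _ _ O1 O2) => //.
  + exact: WWK.
  + exact: WWVK.
  + by move=> p; apply: differentiable_continuous; exact: differentiable_diag_scale.
  + by move=> p; apply: differentiable_continuous; exact: differentiable_diag_scale.
- have PhiK : cancel Phi Psi.
    by apply: pullbackK => //; exact: WWVK.
  have PsiK : cancel Psi Phi.
    by apply: pullbackK => //; exact: WWK.
  split.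
  + by move=> f; exact: pullback_U1.
  + by move=> f g _ _; exact: (can_inj PhiK).
  + by move=> f fU; exists (Psi f) => //; exact: pullback_U1.
Qed.

End Entire.

(** * Reduced spaces *)

Section Induced.
Local Open Scope quotient_scope.
Context (R : realType) (n : nat).
Local Notation C := R[i].
Local Notation V := 'cV[C]_n.+1.
Local Notation V2 := (V * V)%type.
Context (s s' : nat) (T : V2 -> V2) (TZ : @Zhat R n s -> @Zhat R n s')
  (a : Mhat R n s -> Mhat R n s').
Context (dT : forall p, differentiable T p)
  (TZE : forall x, val (TZ x) = T (val x))
  (aE : forall x, a (piMhat x) = piMhat (TZ x)).

Lemma induced_continuous : continuous a.
Proof.
apply/quotient_continuous.
have -> : a \o \pi_(Mhat R n s) = @piMhat R n s' \o TZ.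
  by apply/funext => x; exact: aE.
move=> x; apply: (@continuous_comp _ _ _ TZ); last exact: pi_continuous.
move: x; apply: continuous_comp_initial.
have -> : set_val \o TZ = T \o set_val by apply/funext => x; exact: TZE.
move=> x; apply: (@continuous_comp _ _ _ (@set_val _ _)).
  exact: initial_continuous.
by apply: differentiable_continuous; exact: dT.
Qed.

Lemma induced_holomorphic (g : Mhat R n s' -> C) :
  holM R n s' g -> holM R n s (g \o a).
Proof.
move=> gh x; have [U [h [oU Ux hU hE]]] := gh (TZ x).
exists (T @^-1` U), (h \o T); split.
- apply: open_comp => // p _.
  by apply: differentiable_continuous; exact: dT.
- by rewrite /preimage/= -TZE.
- by move=> p Up; apply: differentiable_comp; [exact: dT|exact: hU].
- by move=> y; rewrite /preimage/= -TZE aE => /hE.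
Qed.

End Induced.

Section Reduced.
Local Open Scope quotient_scope.
Context (R : realType) (n : nat).
Local Notation C := R[i].
Local Notation V := 'cV[C]_n.+1.
Local Notation V2 := (V * V)%type.
Implicit Types (s : nat) (xi eta : V) (p q : V2).

Lemma WV_subproof s (x : @Zhat R n s) :
  diag_scale (wrowV R n s) (val x) \in @Zhat R n n.+1.
Proof.
case: x => p /set_mem/= Zp; apply/mem_set; rewrite /Zhat/= -[RHS]Zp.
rewrite -[in RHS](WWVK s p) /Jhat; apply: eq_bigr => k _.
rewrite WWE /diag_scale /= !mul_diag_mx !mxE /nu ltn_ord.
case: ifP => _; rewrite ?mul1r// mulN1r mulNr [in RHS]mulrACA.
by rewrite -expr2 sqrCi mulN1r opprK.
Qed.

Definition WVZ s (x : @Zhat R n s) : @Zhat R n n.+1 :=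
  @exist _ (fun p => p \in @Zhat R n n.+1) _ (WV_subproof x).

Definition alphaV s (m : Mhat R n s) : Mhat R n n.+1 := piMhat (WVZ (repr m)).

Lemma alphaVE s (x : @Zhat R n s) : alphaV (piMhat x) = piMhat (WVZ x).
Proof.
apply/eqmodP/asboolP.
have /eqmodP/asboolP[a [a0 e]] : \pi_(Mhat R n s) (repr (piMhat x)) = piMhat x.
  by rewrite reprK.
by exists a; split=> //=; rewrite e/= /diag_scale/= !linearZ.
Qed.

Lemma piMhat_surj s (m : Mhat R n s) : exists x : @Zhat R n s, m = piMhat x.
Proof. by exists (repr m); rewrite /piMhat reprK. Qed.

Lemma alphaK s : cancel (@alpha R n s) (@alphaV s).
Proof.
move=> m; have [x ->] := piMhat_surj m; rewrite alphaE alphaVE; congr piMhat.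
by apply/val_inj; exact: WWK.
Qed.

Lemma alphaVK s : cancel (@alphaV s) (@alpha R n s).
Proof.
move=> m; have [x ->] := piMhat_surj m; rewrite alphaVE alphaE; congr piMhat.
by apply/val_inj; exact: WWVK.
Qed.

End Reduced.

Section JhatForm.
Context (R : realType) (n : nat) (s : nat).
Local Notation C := R[i].
Local Notation V := 'cV[C]_n.+1.
Local Notation V2 := (V * V)%type.
Implicit Types (xi eta : V) (p q : V2).
Local Notation B := (@Jhat R n s).

Lemma JhatDr xi eta eta' : B (xi, eta + eta') = B (xi, eta) + B (xi, eta').
Proof. by rewrite /Jhat -big_split/=; apply: eq_bigr => k _; rewrite mxE mulrDr. Qed.

Lemma JhatDl xi xi' eta : B (xi + xi', eta) = B (xi, eta) + B (xi', eta).
Proof.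
by rewrite /Jhat -big_split/=; apply: eq_bigr => k _; rewrite mxE mulrDr mulrDl.
Qed.

Lemma JhatZl c xi eta : B (c *: xi, eta) = c * B (xi, eta).
Proof. by rewrite /Jhat mulr_sumr/=; apply: eq_bigr => k _; rewrite mxE; ring. Qed.

Lemma JhatZr c xi eta : B (xi, c *: eta) = c * B (xi, eta).
Proof. by rewrite /Jhat mulr_sumr/=; apply: eq_bigr => k _; rewrite mxE; ring. Qed.

Lemma JhatBr xi eta eta' : B (xi, eta - eta') = B (xi, eta) - B (xi, eta').
Proof. by rewrite -scaleN1r JhatDr JhatZr mulN1r. Qed.

Lemma JhatBl xi xi' eta : B (xi - xi', eta) = B (xi, eta) - B (xi', eta).
Proof. by rewrite -scaleN1r JhatDl JhatZl mulN1r. Qed.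

Definition e0 : V := delta_mx 0 0.

Lemma Jhat_e0 eta : (0 < s)%N -> B (e0, eta) = eta 0 0.
Proof.
move=> s0; rewrite /Jhat (bigD1 0)//= big1 ?addr0; last first.
  by move=> k k0; rewrite /e0 mxE (negbTE k0)/= mulr0 mul0r.
by rewrite /e0 mxE !eqxx /nu s0 !mul1r.
Qed.

Lemma Jhat_Delta (rho : V) : B (Delta rho) = J s rho.
Proof. by apply: eq_bigr => k _; rewrite /Delta /= mxE. Qed.

Lemma J_real (rho : V) : J s rho \is Num.real.
Proof.
apply: rpred_sum => k _; rewrite -mulrA; apply: realM.
  by rewrite /nu; case: ifP => _; rewrite ?rpredN realE ler01.
by rewrite -normCK realE exprn_ge0.
Qed.

Lemma differentiable_Jhat p : differentiable B p.
Proof.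
have -> : B = \sum_(k < n.+1) (fun p : V2 => nu R s k * p.1 k 0 * p.2 k 0).
  by apply/funext => q; rewrite fct_sumE.
have coord (k : 'I_n.+1) (v : V) : differentiable (fun w : V => w k 0 : C) v.
  exact: differentiable_coord.
apply: differentiable_sum => k.
apply: (@differentiableM _ _ (fun p : V2 => nu R s k * p.1 k 0) (fun p : V2 => p.2 k 0)).
  apply: (@differentiableM _ _ (fun p : V2 => nu R s k) (fun p : V2 => p.1 k 0)).
    exact: differentiable_cst.
  apply: (@differentiable_comp _ _ _ _ fst (fun w : V => w k 0 : C)) => //.
  exact: differentiable_fst.
apply: (@differentiable_comp _ _ _ _ snd (fun w : V => w k 0 : C)) => //.
exact: differentiable_snd.
Qed.

Definition normalize p : V2 := ((B p)^-1 *: p.1, p.2).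

Lemma differentiable_normalize p : B p != 0 -> differentiable normalize p.
Proof.
move=> Bp; apply: differentiable_pair; last exact: differentiable_snd.
have H : differentiable (fun q => (B q)^-1) p.
  by apply: differentiableV => //; exact: differentiable_Jhat.
have bil : (fun q : V2 => (B q)^-1 *: q.1) =
    \sum_(k < n.+1) (fun q : V2 => ((B q)^-1 * q.1 k 0) *: (delta_mx k 0 : V)).
  apply/funext => w; rewrite fct_sumE; apply/colP => k.
  rewrite mxE summxE (bigD1 k)//= big1 ?addr0.
    by rewrite !mxE !eqxx mulr1.
  by move=> j jk; rewrite !mxE eq_sym (negbTE jk)/= !mulr0.
rewrite bil; apply: differentiable_sum => k; apply: differentiableZl.
apply: (@differentiableM _ _ (fun q => (B q)^-1) (fun q : V2 => q.1 k 0)) => //.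
apply: (@differentiable_comp _ _ _ _ fst (fun w : V => w k 0 : C)).
  exact: differentiable_fst.
exact: differentiable_coord.
Qed.

Lemma normalize_Zhat p : B p != 0 -> @Zhat R n s (normalize p).
Proof. by case: p => xi eta Bp; rewrite /Zhat /normalize /= JhatZl mulVf. Qed.

End JhatForm.

Section NormBounds.
Context (R : realType) (n : nat).
Local Notation C := R[i].
Local Notation V := 'cV[C]_n.+1.
Local Notation V2 := (V * V)%type.

Lemma norm_conjv (v : V) : `|conjv v| = `|v|.
Proof.
rewrite /Num.Def.normr/= /mx_norm; congr (_%:num); apply: eq_bigr => ij _.
by apply/val_inj; rewrite /= mxE norm_conjC.
Qed.

Lemma norm_pair_le (v w : V) (r : C) : `|v| <= r -> `|w| <= r -> `|(v, w)| <= r.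
Proof.
move=> vr wr; rewrite /Num.Def.normr/=.
have cmp : `|v| >=< `|w| by rewrite real_comparable// normr_real.
by rewrite comparable_ge_max// vr wr.
Qed.

Lemma norm_fst_le (p : V2) : `|p.1| <= `|p|.
Proof.
rewrite [leRHS]/Num.Def.normr/=.
have cmp : `|p.1| >=< `|p.2| by rewrite real_comparable// normr_real.
by rewrite comparable_le_max// lexx.
Qed.

Lemma norm_snd_le (p : V2) : `|p.2| <= `|p|.
Proof.
rewrite [leRHS]/Num.Def.normr/=.
have cmp : `|p.1| >=< `|p.2| by rewrite real_comparable// normr_real.
by rewrite comparable_le_max// lexx orbT.
Qed.

Lemma norm_Delta_le (v : V) (r : C) : `|v| <= r -> `|Delta v| <= r.
Proof. by move=> vr; apply: norm_pair_le; rewrite ?norm_conjv. Qed.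

Lemma norm_re_part (p : V2) : `|re_part p| <= `|p|.
Proof.
rewrite /re_part normrZ normfV [`|2|]ger0_norm// ler_pdivrMl// mulr_natl mulr2n.
rewrite (le_trans (ler_normD _ _))// lerD ?norm_fst_le// norm_conjv.
exact: norm_snd_le.
Qed.

Lemma norm_im_part (p : V2) : `|im_part p| <= `|p|.
Proof.
rewrite /im_part normrZ normfV normrM normCi mulr1 [`|2|]ger0_norm//.
rewrite ler_pdivrMl// mulr_natl mulr2n.
rewrite (le_trans (ler_normB _ _))// lerD ?norm_fst_le// norm_conjv.
exact: norm_snd_le.
Qed.

End NormBounds.

Lemma near_preimage (T U : topologicalType) (g : T -> U) (x : T) (P : set U) :
  {for x, continuous g} -> nbhs (g x) P -> \forall y \near x, P (g y).
Proof. by move=> cg xP; exact: cg. Qed.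

Lemma pair_lineE (K : numFieldType) (V : normedModType K) (a b c d : V) (t : K) :
  (a, b) + t *: (c, d) = (a + t *: c, b + t *: d) :> V * V.
Proof. by []. Qed.

Section Uniqueness.
Local Open Scope quotient_scope.
Context (R : realType) (n : nat) (s : nat).
Context (s0 : (0 < s)%N).
Local Notation C := R[i].
Local Notation V := 'cV[C]_n.+1.
Local Notation V2 := (V * V)%type.
Implicit Types (xi eta : V) (p q : V2).
Local Notation B := (@Jhat R n s).
Local Notation e0 := (e0 R n).

Context (d : Mhat R n s -> C).
Context (dh : holM R n s d) (d0 : d \o @Delta_red R n s = cst 0).

Definition in_Zhat p (pZ : p \in @Zhat R n s) : @Zhat R n s :=
  @exist _ (fun p => p \in @Zhat R n s) p pZ.

Definition lift p : C :=
  if pselect (p \in @Zhat R n s) is left pZ then d (piMhat (in_Zhat pZ)) else 0.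

Lemma liftE (x : @Zhat R n s) : lift (val x) = d (piMhat x).
Proof.
rewrite /lift; case: pselect => [pZ|/(_ (valP x))//].
by congr (d (piMhat _)); apply/val_inj.
Qed.

Lemma lift_scale (a : C) p : a != 0 -> @Zhat R n s p ->
  lift (a *: p.1, a^-1 *: p.2) = lift p.
Proof.
move=> a0 pZ.
have pZ' : p \in @Zhat R n s by exact/mem_set.
have qZ : (a *: p.1, a^-1 *: p.2) \in @Zhat R n s.
  apply/mem_set; rewrite /Zhat/= JhatZl JhatZr mulrA mulfV// mul1r.
  by rewrite -surjective_pairing; exact: pZ.
rewrite (liftE (in_Zhat pZ')) (liftE (in_Zhat qZ)); congr d.
apply/esym/eqmodP/asboolP; by exists a.
Qed.

(* The homogeneous extension of [d] to the open set where [Jhat] is nonzero. *)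
Definition hext p : C := lift (normalize s p).

Lemma hext_scale (a b : C) p : a != 0 -> b != 0 -> B p != 0 ->
  hext (a *: p.1, b *: p.2) = hext p.
Proof.
move=> a0 b0 Bp.
have := lift_scale (invr_neq0 b0) (normalize_Zhat Bp).
rewrite invrK /hext => <-; congr lift; rewrite /normalize /= JhatZl JhatZr.
rewrite -surjective_pairing !scalerA; congr (_ *: _, _).
by field; rewrite a0 b0 Bp.
Qed.

Lemma hext_Zhat (x : @Zhat R n s) : hext (val x) = d (piMhat x).
Proof.
rewrite -liftE; congr lift; have /set_mem := valP x; rewrite /Zhat/= => Bx.
by rewrite /normalize Bx invr1 scale1r -surjective_pairing.
Qed.

Lemma hext_Delta (rho : V) : 0 < J s rho -> hext (Delta rho) = 0.
Proof.
move=> Jp; pose a := (sqrtC (J s rho))^-1.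
have ap : 0 < a by rewrite invr_gt0 sqrtC_gt0.
have aJ : a * (a * J s rho) = 1.
  have r0 : sqrtC (J s rho) != 0 by rewrite gt_eqF// sqrtC_gt0.
  by rewrite -[X in a * (a * X)]sqrtCK /a; field.
have Daa : (a *: (Delta rho).1, a *: (Delta rho).2) = Delta (a *: rho).
  rewrite /Delta /=; congr pair; rewrite /conjv map_mxZ; congr (_ *: _).
  exact/esym/(geC0_conj (ltW ap)).
have aZ : (a *: rho) \in @Z R n s.
  apply/mem_set; rewrite /Z/= -Jhat_Delta -Daa JhatZl JhatZr.
  by rewrite -surjective_pairing Jhat_Delta.
have BD : B (Delta rho) != 0 by rewrite Jhat_Delta gt_eqF.
have an0 : a != 0 by rewrite gt_eqF.
rewrite -(hext_scale an0 an0 BD) Daa.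
pose x : @Z R n s := @exist _ (fun v => v \in @Z R n s) _ aZ.
have : d (piMhat (DeltaZ x)) = 0.
  by rewrite -Delta_redE; exact: (congr1 (@^~ (piM x)) d0).
by rewrite -hext_Zhat.
Qed.

Lemma hext_curve (l : C -> V2) (t : C) : differentiable l t -> B (l t) != 0 ->
  differentiable (hext \o l) t.
Proof.
move=> dl Bl.
have lZ : normalize s (l t) \in @Zhat R n s by apply/mem_set; exact: normalize_Zhat.
have [U [h [oU Ux hU hE]]] := dh (in_Zhat lZ).
have dB : differentiable (B \o l) t.
  by apply: differentiable_comp => //; exact: differentiable_Jhat.
have dn : differentiable (normalize s \o l) t.
  by apply: differentiable_comp => //; exact: differentiable_normalize.
apply/derivable1_diffP.
apply: (@near_eq_derivable _ _ _ (h \o (normalize s \o l))); last first.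
  by apply/derivable1_diffP; apply: differentiable_comp => //; exact: hU.
have nU : \forall w \near t, U (normalize s (l w)).
  apply: (differentiable_continuous dn); apply: open_nbhs_nbhs; split => //.
have nB : \forall w \near t, B (l w) != 0.
  exact: (cvgr_neq0 _ (differentiable_continuous dB)).
near=> w.
have Bw : B (l w) != 0 by near: w.
have wZ : normalize s (l w) \in @Zhat R n s by apply/mem_set; exact: normalize_Zhat.
rewrite /hext /= (liftE (in_Zhat wZ)) hE//=.
by near: w.
Unshelve. all: by end_near. Qed.

Lemma hext_near_e0 : \forall p \near (e0, e0), hext p = 0.
Proof.
have B1 : B (e0, e0) = 1 by rewrite Jhat_e0// mxE !eqxx.
have : \forall p \near (e0, e0), `|1 - B p| < 1.
  have := differentiable_continuous (differentiable_Jhat s (e0, e0)).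
  by move=> /cvgrPdist_lt/(_ 1 ltr01); rewrite B1.
move=> /nbhs_normP[e /= ep eB].
have De0 : Delta e0 = (e0, e0).
  rewrite /Delta; congr pair; apply/colP => k; rewrite !mxE.
  exact: rmorph_nat.
apply/nbhs_normP; exists (e / 17) => /=; first by rewrite divr_gt0.
move=> p; rewrite /ball_/= distrC => pe.
rewrite -[p](subrK (e0, e0)) [p - _]Delta_re_im.
set q := p - _ in pe *; set P := re_part q; set Q := im_part q.
pose l (t : C) := Delta (P + e0) + t *: Delta Q.
have lE t : l t = Delta P + t *: Delta Q + (e0, e0).
  rewrite /l -De0 addrAC; congr (_ + _); rewrite /Delta /=; congr pair.
  by apply/colP => k; rewrite !mxE rmorphD.
have near_l (t : C) : `|t| <= 16 -> `|1 - B (l t)| < 1.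
  move=> t16; apply: eB; rewrite /= distrC lE addrK.
  apply: le_lt_trans (ler_normD _ _) _; rewrite normrZ.
  have h1 : `|Delta P| <= `|q| by apply: norm_Delta_le; exact: norm_re_part.
  have h2 : `|Delta Q| <= `|q| by apply: norm_Delta_le; exact: norm_im_part.
  apply: le_lt_trans (lerD h1 (ler_pM _ _ t16 h2)) _ => //.
  rewrite -[X in X + _]mul1r -mulrDl (_ : 1 + 16 = 17 :> C); last by ring.
  by rewrite mulrC -ltr_pdivlMr.
rewrite -lE; suff : (hext \o l) 'i = 0 by [].
apply: (@identity_disc _ _ 1 1).
- exact: ltr01.
- exact: ltr01.
- rewrite mulr1 => z z16; apply: hext_curve; first exact: differentiable_line.
  have z16' : `|z| <= 16 by rewrite (le_trans z16)// rmorph_nat.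
  apply/eqP => Bz; have := near_l _ z16'.
  by rewrite Bz subr0 normr1 ltxx.
- move=> x /andP[x0 x1]; rewrite /= /l Delta_real_line; apply: hext_Delta.
  have x16 : `|(x%:C)%C : C| <= 16.
    rewrite normC_real gtr0_norm// -(rmorph_nat (real_complex R)) lecR.
    by rewrite (le_trans (ltW x1))// ler1n.
  have := near_l _ x16; rewrite /l Delta_real_line Jhat_Delta.
  have Jr := J_real s (P + e0 + (x%:C)%C *: Q).
  rewrite real_ltr_norml ?rpredB ?rpred1// => /andP[_].
  by rewrite ltrBlDr ltrDl.
- by rewrite normCi; exact: lexx.
Qed.

Lemma hext_line (p q : V2) : (forall t : C, B (p + t *: q) = 1) ->
  (\forall t \near 0, hext (p + t *: q) = 0) -> forall t, hext (p + t *: q) = 0.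
Proof.
move=> B1 /nearC_ex[e ep H] t; have [r r0 tr] := normC_ex t.
suff : (hext \o (fun t : C => p + t *: q)) t = 0 by [].
apply: (@identity_disc _ _ (r + 1) e).
- by rewrite ltr_wpDl.
- exact: ep.
- move=> z _; apply: hext_curve; first exact: differentiable_line.
  by rewrite B1 oner_eq0.
- move=> x /andP[x0 xe]; apply: H.
  by rewrite subr0 normC_real gtr0_norm// ltcR.
- by rewrite tr lecR lerDl.
Qed.

Lemma hext_xi_near_e0 : \forall xi \near e0, forall eta, B (xi, eta) = 1 ->
  hext (xi, eta) = 0.
Proof.
have B1 : B (e0, e0) = 1 by rewrite Jhat_e0// mxE !eqxx.
pose eta1 (xi : V) : V := (B (xi, e0))^-1 *: e0.
have dBe : differentiable (fun xi : V => B (xi, e0)) e0.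
  apply: (@differentiable_comp _ _ _ _ (fun xi : V => (xi, e0) : V2) B).
    by apply: differentiable_pair; [exact: differentiable_id|exact: differentiable_cst].
  exact: differentiable_Jhat.
pose g (xi : V) : V2 := (xi, eta1 xi).
have dg : differentiable g e0.
  apply: differentiable_pair; first exact: differentiable_id.
  apply: differentiableZl; apply: differentiableV => //.
  by rewrite B1 oner_eq0.
pose N : set V2 := [set p | hext p = 0].
have n1 : \forall xi \near e0, interior N (g xi).
  apply: near_preimage; first exact: (differentiable_continuous dg).
  rewrite /g /eta1 B1 invr1 scale1r; apply: nbhs_interior.
  exact: hext_near_e0.
have n2 : \forall xi \near e0, B (xi, e0) != 0.
  by apply: (cvgr_neq0 _ (differentiable_continuous dBe)); rewrite B1 oner_eq0.
near=> xi => eta Bxi.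
have Bn : B (xi, e0) != 0 by near: xi.
have Nxi : interior N (g xi) by near: xi.
have Be : B (xi, eta1 xi) = 1 by rewrite JhatZr mulVf.
pose l (t : C) : V2 := (xi, eta1 xi) + t *: (0, eta - eta1 xi).
have -> : (xi, eta) = (xi, eta1 xi) + 1 *: (0, eta - eta1 xi) :> V2.
  by rewrite pair_lineE !scale1r addr0 addrC subrK.
apply: hext_line.
  move=> t; rewrite pair_lineE scaler0 addr0 JhatDr Be JhatZr JhatBr Be Bxi.
  by rewrite subrr mulr0 addr0.
have cl : {for 0, continuous l}.
  by apply: differentiable_continuous; exact: differentiable_line.
have Nl : nbhs (l 0) N by rewrite /l scale0r addr0.
exact: (near_preimage cl Nl).
Unshelve. all: by end_near. Qed.

Lemma hext_eta_e0 xi eta : B (xi, eta) = 1 -> B (e0, eta) = 1 ->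
  hext (xi, eta) = 0.
Proof.
move=> Bxi Be.
have -> : (xi, eta) = (e0, eta) + 1 *: (xi - e0, 0) :> V2.
  by rewrite pair_lineE !scale1r !addr0 addrC subrK.
have Bl t : B ((e0, eta) + t *: (xi - e0, 0)) = 1.
  rewrite pair_lineE scaler0 addr0 JhatDl JhatZl JhatBl Be Bxi.
  by rewrite subrr mulr0 addr0.
apply: hext_line => //.
pose g (t : C) : V := e0 + t *: (xi - e0).
have cg : {for 0, continuous g}.
  apply: differentiable_continuous; apply: differentiableD.
    exact: differentiable_cst.
  by apply: differentiableZl; exact: differentiable_id.
pose N : set V := [set xi' | forall eta, B (xi', eta) = 1 -> hext (xi', eta) = 0].
have Ng : nbhs (g 0) N by rewrite /g scale0r addr0; exact: hext_xi_near_e0.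
have Nt := near_preimage cg Ng.
near=> t; have /(_ eta) H : N (g t) by near: t.
have -> : (e0, eta) + t *: (xi - e0, 0) = (e0 + t *: (xi - e0), eta) :> V2.
  by rewrite pair_lineE scaler0 addr0.
by apply: H; rewrite -[RHS](Bl t) pair_lineE scaler0 addr0.
Unshelve. all: by end_near. Qed.

Lemma hext_eta_neq0 xi eta : B (xi, eta) = 1 -> eta 0 0 != 0 ->
  hext (xi, eta) = 0.
Proof.
move=> Bxi eta0; have eta0V := invr_neq0 eta0.
rewrite -(@hext_scale (eta 0 0) (eta 0 0)^-1) ?Bxi ?oner_eq0//=.
apply: hext_eta_e0; first by rewrite JhatZl JhatZr mulrA mulfV// mul1r.
by rewrite JhatZr Jhat_e0// mulVf.
Qed.

Lemma hext_eq0 xi eta : B (xi, eta) = 1 -> hext (xi, eta) = 0.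
Proof.
move=> Bxi; have [eta0|] := eqVneq (eta 0 0) 0; last exact: hext_eta_neq0.
pose beta := e0 - B (xi, e0) *: eta.
have Bbeta : B (xi, beta) = 0 by rewrite JhatBr JhatZr Bxi mulr1 subrr.
have beta0 : beta 0 0 = 1 by rewrite !mxE eta0 mulr0 subr0 !eqxx.
pose l (t : C) : V2 := (xi, eta) + t *: (0, beta).
have lE t : l t = (xi, eta + t *: beta).
  by rewrite /l pair_lineE scaler0 addr0.
have Bl t : B (l t) = 1 by rewrite lE JhatDr JhatZr Bbeta mulr0 addr0.
have -> : (xi, eta) = l 0 by rewrite lE scale0r addr0.
suff : (hext \o l) 0 = 0 by [].
apply: (@identity_disc _ _ 1 1).
- exact: ltr01.
- exact: ltr01.
- move=> z _; apply: hext_curve; first exact: differentiable_line.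
  by rewrite Bl oner_eq0.
- move=> x /andP[x0 _]; rewrite /= lE; apply: hext_eta_neq0.
    by rewrite -lE.
  have -> : (eta + (x%:C)%C *: beta) 0 0 = eta 0 0 + (x%:C)%C * beta 0 0.
    by rewrite mxE [in X in _ + X = _]mxE.
  by rewrite eta0 beta0 add0r mulr1 gt_eqF// ltcR.
- by rewrite normr0 ler0c ler01.
Qed.

Lemma holM_eq0 m : d m = 0.
Proof.
have [x ->] := piMhat_surj m; rewrite -hext_Zhat.
have /set_mem := valP x; rewrite /Zhat/=; case: (val x) => xi eta.
exact: hext_eq0.
Qed.

End Uniqueness.

Lemma holM_unique_extension (R : realType) (n s : nat) : (0 < s)%N ->
  unique_extension (holM R n s) (@Delta_red R n s).
Proof.
move=> s0 f g fh gh fg.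
pose d m := f m + -1 * g m.
have dh : holM R n s d by apply: funalg_add => //; exact: funalg_scale.
have d0 : d \o @Delta_red R n s = cst 0.
  apply/funext => m; have := congr1 (@^~ m) fg.
  by rewrite /d /= => ->; rewrite mulN1r subrr.
apply/funext => m; have := holM_eq0 s0 dh d0 m.
by rewrite /d mulN1r => /eqP; rewrite subr_eq0 => /eqP.
Qed.

Lemma reduced_wick_rotation_exists (R : realType) (n s : nat) : (0 < s)%N ->
  exists Phi_red : A_Mred R n s -> A_Mred R n n.+1,
    is_reduced_wick_rotation Phi_red /\ homeomorphic_alg_isomorphism Phi_red.
Proof.
move=> s0.
have uniq := @holM_unique_extension R n s s0.
have uniq' := @holM_unique_extension R n n.+1 (ltn0Sn n).
have dW p : differentiable (@WW R n s) p by exact: differentiable_diag_scale.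
have dV p : differentiable (diag_scale (wrowV R n s)) p.
  exact: differentiable_diag_scale.
have O1 (g : Mhat R n s -> R[i]) : holM R n s g -> holM R n n.+1 (g \o @alpha R n s).
  exact: (induced_holomorphic dW (TZ := @WWZ R n s) (fun=> erefl) (@alphaE R n s)).
have O2 (g : Mhat R n n.+1 -> R[i]) : holM R n n.+1 g -> holM R n s (g \o @alphaV R n s).
  exact: (induced_holomorphic dV (TZ := @WVZ R n s) (fun=> erefl) (@alphaVE R n s)).
exists (pullback (@Delta_red R n n.+1) O1); split.
  by move=> ghat g gh gE; exact: (pullbackE _ O1 uniq gh gE).
apply: (@pullback_isomorphism _ _ _ _ _ _ _ _ _ _ _ O1 O2) => //.
- exact: alphaK.
- exact: alphaVK.
- exact: (induced_continuous dW (TZ := @WWZ R n s) (fun=> erefl) (@alphaE R n s)).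
- exact: (induced_continuous dV (TZ := @WVZ R n s) (fun=> erefl) (@alphaVE R n s)).
Qed.

Theorem theorem6p4 (R : realType) (n s : nat)
    (hn : (1 <= n)%N) (hs : (1 <= s <= n.+1)%N) :
  (exists Phi : A_V R n -> A_V R n,
    [/\ is_wick_rotation s Phi,
        homeomorphic_alg_isomorphism Phi &
        set_bij (@A_V_U1 R n) (@A_V_U1 R n) Phi]) /\
  (exists Phi_red : A_Mred R n s -> A_Mred R n n.+1,
    is_reduced_wick_rotation Phi_red /\
    homeomorphic_alg_isomorphism Phi_red).
Proof.
split; first exact: wick_rotation_exists.
by apply: reduced_wick_rotation_exists; case/andP: hs.
Qed.
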